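(* Let $G$ be a finite $2$-Frobenius group and let $F$ denote the Fitting subgroup of $G$. If $G$ is either character-quadratic or semi-rational, then one of the following conclusions holds. (a) $F$ is a $2$-group, and the Frobenius group $G/F$ is of the form $C_3\rtimes C_2$ or $C_5\rtimes C_4$. (b) The set of prime divisors of $|F|$ is contained in $\{2,3\}$, and the Frobenius group $G/F$ is of the form $C_5\rtimes C_2$, $C_7\rtimes C_3$, $C_7\rtimes C_6$ or $C_{13}\rtimes C_6$. Moreover, for each of the structures listed in (a) and (b) (that is, for each of the six listed types of Frobenius group $G/F$, with $F$ as described in the corresponding item), there exists a finite $2$-Frobenius group $G$ with that structure that is both character-quadratic and semi-rational.
   Context: All groups are finite. $C_n$ denotes a cyclic group of order $n$, and $C_n\rtimes C_m$ here denotes a Frobenius group with kernel $C_n$ and complement $C_m$. A group $G$ is a $2$-Frobenius group if it has two normal subgroups $N\le K$ such that $K$ is a Frobenius group with kernel $N$, and $G/N$ is a Frobenius group with kernel $K/N$ (in this situation $N$ is the Fitting subgroup of $G$, so $G/F$ is a Frobenius group). For $\chi\in\mathrm{Irr}(G)$ (the set of complex irreducible characters of $G$), $\mathbb{Q}(\chi)=\mathbb{Q}(\chi(g)\mid g\in G)$; for $x\in G$, $\mathbb{Q}(x)=\mathbb{Q}(\psi(x)\mid \psi\in\mathrm{Irr}(G))$. $G$ is semi-rational if $[\mathbb{Q}(x):\mathbb{Q}]\le 2$ for every $x\in G$ (equivalently, for every $x\in G$ the generators of $\langle x\rangle$ lie in at most two conjugacy classes of $G$). $G$ is character-quadratic if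 $[\mathbb{Q}(\chi):\mathbb{Q}]\le 2$ for every $\chi\in\mathrm{Irr}(G)$. *)

(* Defs.v *)
From mathcomp Require Import all_boot all_order all_algebra all_fingroup.
From mathcomp Require Import all_solvable all_field all_character.

Set Implicit Arguments.
Unset Strict Implicit.
Unset Printing Implicit Defensive.

Local Open Scope group_scope.

(* [Q(s) : Q] for a finite family s of algebraic numbers. By its type,
   num_field_exists s yields a number field, together with an embedding into
   algC, that is generated over rat by the preimages of the elements of s; it
   is thus isomorphic to Q(s), and its dimension does not depend on the
   choice made. *)
Definition Qdegree (s : seq algC) : nat :=
  \dim {: projT1 (num_field_exists s)}%VS.

Definition semi_rational (gT : finGroupType) (G : {group gT}) : Prop :=
  forall x, x \in G -> Qdegree [seq ('chi[G]_i x)%R | i : Iirr G] <= 2.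

Definition character_quadratic (gT : finGroupType) (G : {group gT}) : Prop :=
  forall i : Iirr G, Qdegree [seq ('chi[G]_i x)%R | x in G] <= 2.

Definition two_Frobenius (gT : finGroupType) (G : {group gT}) : Prop :=
  exists N K : {group gT},
    [/\ N <| G, K <| G, N \subset K,
        [Frobenius K with kernel N] & [Frobenius G / N with kernel K / N]].

(* Q is a Frobenius group of the form C_n ><| C_m. *)
Definition Frobenius_cyclic (gT : finGroupType) (Q : {group gT}) (n m : nat)
  : Prop :=
  exists K H : {group gT},
    [/\ [Frobenius Q = K ><| H], cyclic K, #|K| = n, cyclic H & #|H| = m].

(* Main.v *)
Require Import Defs.
From mathcomp Require Import all_boot all_order all_algebra all_fingroup.
From mathcomp Require Import all_solvable all_field all_character.
From mathcomp Require Import ring zify.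

Set Implicit Arguments.
Unset Strict Implicit.
Unset Printing Implicit Defensive.

Import Order.TTheory GRing.Theory Num.Theory FiniteModule.

Local Open Scope group_scope.

(** A set s of algebraic numbers generates a field of degree at most 2 if and
    only if, of any two automorphisms of the algebraic numbers, one fixes s or
    both agree on s (Qdegree_le2_aut, char_values_Qdegree_le2). Since
    automorphisms act on roots of unity as power maps, the two hypotheses on G
    have a common consequence: x is conjugate to x ^+ (k * k) whenever k is
    prime to the order of x (quadratic_sqr_conj).

    Let N <= K be the series of a 2-Frobenius group. The group K / N is
    a Frobenius complement in K and the Frobenius kernel of G / N. It has odd
    order (two_Frobenius_ker_odd), so that its Sylow subgroups are cyclic, and
    it is therefore cyclic itself (Frobenius_ker_Zgroup_cyclic). Moreover G
    splits over N, as N ><| (H ><| C) with H a copy of K / N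
    (two_Frobenius_structure). The square powers of an element of H are
    conjugate under C, which acts freely on H. This forces H to have prime
    order p and C to be cyclic of order m >= (p - 1) / 2. The values of the
    characters of C include the m-th roots of unity, so m is 2, 3, 4 or 6.
    The six types of G / N remain.

    For the primes of #|N| the main tool is Frobenius_coprime_act_cent: if a
    Frobenius group acts on an abelian group of order prime to that of its
    kernel and its complement has no fixed points, then its kernel acts
    trivially. On the one hand it gives, for each prime q dividing #|N|, an
    element v <> 1 that C fixes in the centre of an invariant Sylow q-subgroup
    Q of N. On the other hand it shows that the normaliser of Q in N
    centralises 'Z(Q), so that by Burnside's fusion argument no power of v
    other than v is conjugate to v (central_conj_power). As v is conjugate to
    v ^+ 4 if q is odd, only q = 2 and q = 3 are possible. Consequently N is
    solvable, hence nilpotent, and N = 'F(G). If q = 3 were prime to m > 2, the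
    column of v * c with c a generator of C would have values that involve both
    m-th roots of unity and an independent irrationality of 3-power order, and
    there is a similar row (semi_rational_compl_le2,
    character_quadratic_compl_le2). This excludes 3 if m = 4.

    For the existence statements, let the Frobenius group of affine maps with
    p and m as above act on the functions from 'F_p to a group of order 2 with
    sum 0. In this semidirect product, classes of powers are easy to describe,
    and the irreducible characters vanish on K outside N, or vanish outside K,
    or are trivial on K, so that two automorphisms can be compared on each row
    and on each column (split_semi_rational, split_character_quadratic). *)

(** * Fields of degree at most two *)

Section Quadratic.
Local Open Scope ring_scope.

(** An element that nu1 moves is irrational, so that with 1 it spans a field of
    degree at most 2. It is a root of a rational quadratic polynomial, and any
    automorphism that moves it takes it to the other root. Hence an
    automorphism is determined on s as soon as it moves something in s. *)
Lemma Qdegree_le2_aut (s : seq algC) (nu1 nu2 : {rmorphism algC -> algC}) :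
    (Qdegree s <= 2)%N ->
  [\/ {in s, forall a, nu1 a = a}, {in s, forall a, nu2 a = a}
    | {in s, forall a, nu1 a = nu2 a}].
Proof.
rewrite /Qdegree; case: (num_field_exists s) => L [iota [s1 Ds _]] /= dimL.
have fixP (nu : {rmorphism algC -> algC}) :
    {in s, forall a, nu a = a} \/ exists a, nu (iota a) != iota a.
  have [/allP fix_s|/allPn[x]] := boolP (all (fun a => nu a == a) s).
    by left=> a /fix_s/eqP.
  by rewrite -Ds => /mapP[a _ ->] moves_a; right; exists a.
have [|[a1 nu1a]] := fixP nu1; first by constructor 1.
have [|[a2 nu2a]] := fixP nu2; first by constructor 2.
have Qfix (nu : {rmorphism algC -> algC}) (b : rat) :
    nu (iota b%:A) = iota b%:A by rewrite alg_num_field !fmorph_rat.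
(* If nu moves a, then 1 and a span the field over the rationals. *)
have moved (nu : {rmorphism algC -> algC}) a x : nu (iota a) != iota a ->
    exists b c : rat, x = b%:A + c *: a.
  move=> nu_a; suffices: x \in (1%AS + <[a]>)%VS.
    by case/memv_addP=> _ /vlineP[b ->] [_ /vlineP[c ->] ->]; exists b, c.
  suffices ->: (1%AS + <[a]>)%VS = fullv by apply: memvf.
  have notQa : a \notin 1%VS.
    by apply: contraNN nu_a => /vlineP[b ->]; rewrite Qfix.
  apply/eqP; rewrite eqEdim subvf; apply: leq_trans dimL _.
  have cap0: (1%AS :&: <[a]>)%VS = 0%VS.
    apply/eqP; rewrite -subv0; apply/subvP=> y /memv_capP[Qy /vlineP[c Dy]].
    rewrite memv0 Dy scaler_eq0; apply: contraR notQa; rewrite negb_or.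
    case/andP=> nz_c _; have ->: a = c^-1 *: y by rewrite Dy scalerK.
    by rewrite memvZ.
  rewrite dimv_disjoint_sum // dimv1 dim_vline.
  by case: eqP notQa => // ->; rewrite mem0v.
have nu2a1: nu2 (iota a1) != iota a1.
  apply: contraNneq nu2a => fix_a1; have [b [c ->]] := moved _ _ a2 nu1a.
  by rewrite !rmorphD /= -[c *: a1]mulr_algl !rmorphM /= !Qfix fix_a1.
have [u [w Da1]] := moved _ _ (a1 * a1) nu1a.
have other (nu : {rmorphism algC -> algC}) : nu (iota a1) != iota a1 ->
    nu (iota a1) = iota w%:A - iota a1.
  move=> ne_xy; have := congr1 (nu \o iota) Da1; have := congr1 iota Da1.
  rewrite /= !rmorphD /= -[w *: a1]mulr_algl !rmorphM /= !Qfix.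
  move: ne_xy; set x := nu (iota a1); set y := iota a1;
    set w' := iota w%:A => ne_xy Dy Dx.
  have: (x - y) * (x + y - w') == 0.
    have ->: (x - y) * (x + y - w') = (x * x - w' * x) - (y * y - w' * y)
      by ring.
    by rewrite Dx Dy !addrK subrr.
  by rewrite mulf_eq0 subr_eq0 (negPf ne_xy) subr_eq0 => /eqP <-; rewrite addrK.
constructor 3=> x0; rewrite -Ds => /mapP[x _ ->].
have [b [c ->]] := moved _ _ x nu1a.
by rewrite !rmorphD /= -[c *: a1]mulr_algl !rmorphM /= !Qfix (other nu1) //
  (other nu2).
Qed.

(** The number field behind Qdegree is only given up to isomorphism. This
    compares its degree with that of a subfield of any other number field, in
    particular of a Galois extension, where degrees are read off from
    automorphism groups. *)
Lemma dim_num_field_embedding (L M : fieldExtType rat)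
    (iota : {rmorphism L -> algC}) (jota : {rmorphism M -> algC})
    (E : {subfield M}) (s : seq L) :
    <<1 & s>>%VS = fullv ->
      {in s, forall a, exists2 b, b \in E & jota b = iota a} ->
  (\dim {:L} <= \dim E)%N.
Proof.
move=> genL sE.
have {s genL sE} LE x : exists2 b, b \in E & jota b = iota x.
  have: x \in <<1 & s>>%VS by rewrite genL memvf.
  elim/last_ind: s sE x {genL} => [|s a IHs] sE x.
    rewrite Fadjoin_nil => /vlineP[q ->]; exists q%:A; last first.
      by rewrite !alg_num_field !fmorph_rat.
    by rewrite memvZ ?mem1v.
  have{}IHs y : y \in <<1 & s>>%VS -> exists2 b, b \in E & jota b = iota y.
    by apply: IHs => b sb; apply: sE; rewrite mem_rcons inE sb orbT.
  have [a' Ea' Da'] : exists2 b, b \in E & jota b = iota a.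
    by apply: sE; rewrite mem_rcons mem_head.
  rewrite adjoin_rcons => /Fadjoin_polyP[p /polyOverP Kp ->].
  have /fin_all_exists2[f Ef Df] (i : 'I_(size p)) := IHs _ (Kp i).
  exists (\sum_i f i * a' ^+ i); first by rewrite rpred_sum // => i _;
    rewrite rpredM ?rpredX.
  rewrite horner_coef !rmorph_sum; apply: eq_bigr => i _.
  by rewrite !rmorphM !rmorphXn /= Df Da'.
have /fin_all_exists2[f Ef Df] (i : 'I_(\dim {:L})) := LE (vbasis {:L})`_i.
pose X := [tuple f i | i < \dim {:L}].
suffices /eqP freeX: free X.
  rewrite -[X in (X <= _)%N](size_tuple X) -freeX; apply: dimvS;
    apply/span_subvP=> y.
  by case/mapP=> i _ ->.
apply/freeP=> c c0 i; have /freeP freeL := basis_free (vbasisP {:L});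
  apply: (freeL c).
apply: (fmorph_inj iota); rewrite rmorph0 -(rmorph0 jota) -c0 !rmorph_sum.
apply: eq_bigr => j _; rewrite !rmorphZ_num; congr (_ * _).
by rewrite nth_mktuple Df.
Qed.

(** The values of all characters of G lie in a Galois extension of the
    rationals, with group A say. If J is the stabiliser of s in A, the
    hypothesis says that of any g and h in A one of g, h and g h^-1 is in J. So
    J has index at most 2, and the degree of the field of s is this index. *)
Lemma char_values_Qdegree_le2 (gT : finGroupType) (G : {group gT})
    (s : seq algC) :
    {in s, forall a, exists (i : Iirr G) (x : gT), x \in G /\ a = 'chi_i x} ->
    (forall nu1 nu2 : {rmorphism algC -> algC},
      [\/ {in s, forall a, nu1 a = a}, {in s, forall a, nu2 a = a}
        | {in s, forall a, nu1 a = nu2 a}]) ->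
  (Qdegree s <= 2)%N.
Proof.
move=> sG nuP; have [Q galQ [j gQ [w _ Q_G]]] := group_num_field_exists G.
have [s' Ds]: exists s', s = map j s'.
  elim: s sG {nuP} => [|a s IHs] sG; first by exists nil.
  have [|s' ->] := IHs; first by move=> b sb; apply: sG; rewrite inE sb orbT.
  have [i [x [Gx ->]]] := sG a (mem_head _ _).
  have [b <-] := Q_G _ _ _ (irr_char i) x (order_dvdG Gx).
  by exists (b :: s').
rewrite /Qdegree; case: (num_field_exists s) => L [iota [s1 Ds1 genL]] /=.
pose E := <<1 & s'>>%AS.
apply: (@leq_trans (\dim E)).
  apply: dim_num_field_embedding genL _ => a s1a.
  have: iota a \in s by rewrite -Ds1 map_f.
  by rewrite Ds => /mapP[b s'b Dab]; exists b;
    [exact: seqv_sub_adjoin | exact: esym Dab].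
pose A := 'Gal({:Q} / 1)%g; pose J := 'Gal({:Q} / E)%g.
have galE: galois E {:Q} by apply: galoisS galQ; rewrite sub1v subvf.
have sJA: J \subset A by rewrite galS ?sub1v.
have /galois_fixedField fixJ := galE.
have := dim_fixed_galois galQ sJA; rewrite fixJ dimv1 divn1 => ->.
have memJ g : g \in A -> {in s, forall a, sval (gQ g) a = a} -> g \in J.
  move=> Ag fix_s; rewrite -sub1set galois_connection ?subvf //.
  apply/Fadjoin_seqP; split=> [|a s'a]; first by rewrite sub1v.
  apply/fixedFieldP=> [|_ /set1P->]; first exact: memvf.
  by apply: (fmorph_inj j); rewrite (svalP (gQ g)) fix_s // Ds map_f.
have two g h : g \in A -> h \in A -> [|| g \in J, h \in J | g * h^-1 \in J]%g.
  move=> Ag Ah; have [/memJ-> //|/memJ-> //|gh] :=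
    nuP (sval (gQ g)) (sval (gQ h)).
    by rewrite orbT.
  apply/or3P/Or33; rewrite -sub1set galois_connection ?subvf //.
  apply/Fadjoin_seqP; split=> [|a s'a]; first by rewrite sub1v.
  apply/fixedFieldP=> [|_ /set1P->]; first exact: memvf.
  have Dga : g a = h a.
    by apply: (fmorph_inj j);
      rewrite (svalP (gQ g)) (svalP (gQ h)) gh // Ds map_f.
  by rewrite galM ?memvf // Dga -galM ?memvf // mulgV gal_id.
(* Either A is J, or J and one more coset of J cover A. *)
have [/subset_leq_card le_AJ | /subsetPn[g Ag J'g]] := boolP (A \subset J).
  by rewrite -divgS // leq_divLR ?cardSg // (leq_trans le_AJ) // mul2n -addnn
    leq_addr.
rewrite -divgS // leq_divLR ?cardSg // mul2n -addnn -{2}(card_rcoset J g).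
apply: leq_trans (leq_card_setU _ _); apply/subset_leq_card/subsetP=> h Ah.
rewrite inE mem_rcoset; have := two h g Ah Ag.
by rewrite (negPf J'g).
Qed.

End Quadratic.

(** * Galois action on roots of unity and on character values *)

(** For m > 2 a primitive m-th root of unity is irrational, so that it already
    generates the field of s. An automorphism that fixes this root then fixes
    all of s. *)
Lemma Qdegree_le2_prim_root_fix m (z : algC) (s : seq algC)
    (nu : {rmorphism algC -> algC}) :
    2 < m -> (m.-primitive_root z)%R -> z \in s -> Qdegree s <= 2 ->
    nu z = z ->
  {in s, forall a, nu a = a}.
Proof.
move=> m_gt2 prim_z sz dim_s fixz; have m_gt0 := ltnW (ltnW m_gt2).
have co_m1 : coprime m.-1 m by rewrite coprimePn.
have [nu' nu'E] := Qn_aut_exists co_m1.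
have nu'z : nu' z != z.
  rewrite nu'E ?(prim_expr_order prim_z) // -[X in _ != X]expr1
    (eq_prim_root_expr prim_z).
  by case: m m_gt2 {m_gt0 co_m1 nu'E prim_z} => [|[|[|m]]] // _;
    rewrite !modn_small.
have [//|/(_ z sz)|/(_ z sz)] := Qdegree_le2_aut nu nu' dim_s.
  by move/eqP; rewrite (negPf nu'z).
by rewrite fixz => /esym/eqP; rewrite (negPf nu'z).
Qed.

Lemma aut_expg_exists (nu : {rmorphism algC -> algC}) n : 0 < n ->
  exists2 k, coprime k n & forall z : algC, (z ^+ n = 1 -> nu z = z ^+ k)%R.
Proof.
move=> n_gt0; have [z prim_z] := C_prim_root_exists n_gt0.
have [|k Dk] := prim_rootP prim_z (x := nu z).
  by rewrite -rmorphXn /= (prim_expr_order prim_z) rmorph1.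
exists k => [|_ /(prim_rootP prim_z)[i ->]];
  last by rewrite rmorphXn /= Dk exprAC.
have : (n.-primitive_root (nu z))%R by rewrite fmorph_primitive_root.
by rewrite Dk prim_root_exp_coprime.
Qed.

(** The restriction of chi to the cyclic group of x is a sum of linear
    characters, whose values are roots of unity on which nu is the k-th power
    map. *)
Lemma aut_char_expg (gT : finGroupType) (G : {group gT}) (chi : 'CF(G))
    (nu : {rmorphism algC -> algC}) k x :
    chi \is a character -> x \in G ->
    (forall z, z ^+ #[x] = 1 -> nu z = z ^+ k)%R ->
  nu (chi x) = chi (x ^+ k).
Proof.
move=> Nchi Gx nuE; have sxG: <[x]> \subset G by rewrite cycle_subG.
rewrite -!(cfResE _ sxG) ?cycle_id ?mem_cycle //.
have [r ->] := char_sum_irr (cfRes_char <[x]> Nchi).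
rewrite !sum_cfunE rmorph_sum; apply: eq_bigr => i _.
have lin_i: ('chi[<[x]>]_i)%R \is a linear_char
  by apply: irr_cyclic_lin (cycle_cyclic x).
rewrite lin_charX ?cycle_id // nuE // -lin_charX ?cycle_id //.
by rewrite expg_order lin_char1.
Qed.

(** Let nu raise the roots of unity of order dividing that of x to the k-th
    power. If a value a of a character at x lies in a field of degree at most
    2, then nu^2 fixes a. This argument uses one entry of the character table
    at a time, which is why rows of degree 2 and columns of degree 2 are
    equally good. *)
Lemma quadratic_sqr_conj (gT : finGroupType) (G : {group gT}) x k :
    character_quadratic G \/ semi_rational G -> x \in G -> coprime k #[x] ->
  x ^+ (k * k) \in x ^: G.
Proof.
move=> quadG Gx co_kx; have [nu nuE] := Qn_aut_exists co_kx.
apply/eq_irr_mem_classP=> // i.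
have DchiX: (nu (nu ('chi_i x)) = 'chi_i (x ^+ (k * k))%g)%R.
  rewrite (aut_char_expg (irr_char i) Gx nuE) expgM.
  apply: aut_char_expg; rewrite ?irr_char ?groupX // => z.
  by rewrite orderXgcd gcdnC (eqP co_kx) divn1; apply: nuE.
have [s s_chi dim_s]: exists2 s, ('chi_i x)%R \in s & Qdegree s <= 2.
  case: quadG => [/(_ i)|/(_ x Gx)] quad; eexists; try exact: quad.
    by apply: image_f.
  by apply: image_f.
rewrite -DchiX; have [nu1|nu2|nu12] := Qdegree_le2_aut nu (nu \o nu)%R dim_s.
- by rewrite !nu1.
- exact: (nu2 _ s_chi).
- by have /= /fmorph_inj Da := nu12 _ s_chi; rewrite -!Da.
Qed.

(** * Frobenius groups acting on groups of coprime order *)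

Section FrobeniusActions.

Variable gT : finGroupType.
Implicit Types L M Q V X Y Z : {group gT}.

(** L is the union of X and of the conjugates of Y, any two of which meet in 1.
    Sum the images of v in V over each of these subgroups. The sum over a
    conjugate of Y is fixed by that conjugate, hence is 0, and so is the sum
    over L. What is left says that the sum over X is a multiple of v. The
    multiplier is the number of conjugates of Y, which divides the order of X
    and so is prime to that of V. As the sum over X is fixed by X, so is v. *)
Lemma Frobenius_coprime_act_cent L X Y V :
    [Frobenius L = X ><| Y] -> abelian V -> L \subset 'N(V) ->
    coprime #|X| #|V| -> 'C_V(Y) = 1 ->
  X \subset 'C(V).
Proof.
move=> frobL abV nVL coXV regY.
have [/sdprodP[_ /mulG_sub[sXL sYL] _ _] _ ntY _ _] := Frobenius_context frobL.
pose avg (A : {group gT}) (u : fmod_of abV) : fmod_of abV :=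
  (\sum_(a in A) actr u a)%R.
have avg_fix (A : {group gT}) (u : fmod_of abV) a : A \subset L -> a \in A ->
  actr (avg A u) a = avg A u.
  move=> sAL Aa; rewrite actr_sum [RHS](reindex_inj (mulIg a)) /=.
  rewrite [RHS](eq_bigl [in A]) => [|b]; last by rewrite groupMr.
  by apply: eq_bigr => b Ab; rewrite actrM ?(subsetP nVL) ?(subsetP sAL).
have avg_cent (A : {group gT}) u : A \subset L -> val (avg A u) \in 'C_V(A).
  move=> sAL; rewrite inE fmodP; apply/centP=> a Aa; apply/commgP/conjg_fixP.
  by rewrite -fmvalJ ?(subsetP nVL) ?(subsetP sAL) // avg_fix.
have avgY x u : x \in X -> avg (Y :^ x)%G u = 0%R.
  move=> Xx; apply: val_inj; apply/set1P;
    rewrite -[[set _]](conjs1g x) -regY conjIg.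
  rewrite -centJ (normsP (subset_trans sXL nVL)) // avg_cent //.
  by rewrite -(conjGid (subsetP sXL x Xx)) conjSg.
have avgL u : avg L u = 0%R.
  apply: val_inj; apply/set1P; rewrite -[[set _]]regY.
  by apply: subsetP (avg_cent L u _) => //; rewrite setIS ?centS.
pose n := #|Y^# :^: X|.
have sum_avg u : (avg X u = u *+ n)%R.
  have partL := Frobenius_partition frobL; have /and3P[_ tiL _] := partL.
  have notXY : gval X \notin Y^# :^: X.
    apply/imsetP=> [[x _ /setP/(_ 1)]]; by rewrite group1 conjD1g setD11.
  have := avgL u; rewrite /avg (set_partition_big _ partL) /= big_setU1 //= =>
    sum0.
  apply/eqP; rewrite -subr_eq0 /n -sumr_const -sumrN; apply/eqP.
  rewrite -[RHS]sum0; congr (_ + _)%R; apply: eq_bigr => _ /imsetP[x Xx ->].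
  have /eqP := avgY x u Xx;
    rewrite /avg (big_setD1 1) ?group1 //= actr1 addrC addr_eq0.
  by rewrite conjD1g => /eqP.
have co_Vn : coprime #|V| n.
  by rewrite coprime_sym (coprime_dvdl _ coXV) // /n (dvdn_orbit 'Js X).
apply/subsetP=> x Xx; apply/centP=> v Vv; apply/esym/commgP/conjg_fixP.
have nVx : x \in 'N(V) by rewrite (subsetP nVL) ?(subsetP sXL).
have := avg_fix X (fmod abV v) x sXL Xx; rewrite sum_avg -fmodX // -fmodJ //.
move/(congr1 val); rewrite !fmodK ?memJ_norm ?groupX //.
by rewrite conjXg => /(can_in_inj (expgK co_Vn)); apply; rewrite ?memJ_norm.
Qed.

(** It suffices to treat one prime r at a time. For r = q the hypothesis on Q
    applies. Otherwise Y normalises some Sylow r-subgroup R of M, and the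
    Frobenius group R <*> Y acts on V with R coprime to V and Y without fixed
    points. *)
Lemma Frobenius_p'_act_cent L X Y M V (q : nat) :
    [Frobenius L = X ><| Y] -> solvable Y -> M \subset X -> V \subset X ->
    Y \subset 'N(M) -> abelian V -> q.-group V -> M <*> Y \subset 'N(V) ->
  forall Q Z, Z \subset V -> q.-Sylow(M) Q -> Q \subset 'C(Z) ->
    M \subset 'C(Z).
Proof.
move=> frobL solY sMX sVX nMY abV qV nV_MY Q Z sZV sylQ cZQ.
have [nVM nVY] : M \subset 'N(V) /\ Y \subset 'N(V) by apply/andP;
  rewrite -join_subG.
have coMY : coprime #|M| #|Y| := coprimeSg sMX (Frobenius_coprime frobL).
have regY : 'C_V(Y) = 1.
  by apply/trivgP; rewrite -(Frobenius_trivg_cent frobL) setSI.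
apply/setIidPl/eqP; rewrite eqEcard subsetIl dvdn_leq ?cardG_gt0 //.
apply/dvdn_partP=> // r _; have [->|r_neq_q] := eqVneq r q.
  by rewrite -(card_Hall sylQ) cardSg // subsetI (pHall_sub sylQ).
have [R sylR nRY] := sol_coprime_Sylow_exists r solY nMY coMY.
have [sRM rR _] := and3P sylR.
rewrite -(card_Hall sylR) cardSg // subsetI sRM.
have [-> | ntR] := eqVneq R 1%G; first exact: sub1G.
have frobRY := Frobenius_subl ntR (subset_trans sRM sMX) nRY frobL.
apply: subset_trans (centS sZV); 
  apply: (Frobenius_coprime_act_cent frobRY) => //.
  by rewrite join_subG (subset_trans sRM).
rewrite (pnat_coprime rR) //; apply: sub_in_pnat qV => p _ /eqP->.
by rewrite !inE eq_sym.
Qed.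

(** Together with Sylow_center_fusion, this says that inside X distinct
    elements of 'Z(Q) are never conjugate. *)
Lemma Frobenius_norm_Sylow_cent L X Y Q (q : nat) :
    [Frobenius L = X ><| Y] -> solvable Y -> q.-Sylow(X) Q -> Y \subset 'N(Q) ->
  'N_X(Q) \subset 'C('Z(Q)).
Proof.
move=> frobL solY sylQ nQY; have [sQX qQ _] := and3P sylQ.
have [defL _ _ _ _] := Frobenius_context frobL.
have [_ _ nXY _] := sdprodP defL.
have sylQN : q.-Sylow('N_X(Q)) Q.
  by apply: (pHall_subl _ (subsetIl _ _) sylQ); rewrite subsetI sQX normG.
apply: (Frobenius_p'_act_cent frobL _ _ _ _ _ _ _ (subxx _) sylQN);
  rewrite ?subsetIl //.
- by rewrite (subset_trans (center_sub _)).
- by rewrite normsI // norms_norm.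
- exact: center_abelian.
- by rewrite (pgroupS (center_sub _)).
- rewrite (char_norm_trans (center_char Q)) // join_subG subsetIr //.
by rewrite centsC subsetIr.
Qed.

End FrobeniusActions.

(** Induction on the order of X. Let V be a minimal normal subgroup of L inside
    X, which is an elementary abelian s-group. By induction X / V is nilpotent,
    so it is enough to see that V is central in X. The centre of a Y-invariant
    Sylow s-subgroup S of X meets V non-trivially, and X centralises this
    intersection, so that 'C_V(X) is not trivial and is V by minimality. *)
Lemma Frobenius_sol_kernel_nil (gT : finGroupType) (L X Y : {group gT}) :
  [Frobenius L = X ><| Y] -> solvable Y -> solvable X -> nilpotent X.
Proof.
have [n] := ubnP #|X|; elim: n => // n IHn in gT L X Y *.
move=> /ltnSE-leXn frobL solY solX.
have [defL ntX ntY _ _] := Frobenius_context frobL.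
have [nsXL sYL mulXY nXY _] := sdprod_context defL.
have [V minV sVX] := minnormal_exists ntX (normal_norm nsXL).
have [nVL ntV abelV] := minnormal_solvable minV sVX solX.
have [_ minV'] := mingroupP minV.
have nsVL : V <| L by rewrite /normal (subset_trans sVX (normal_sub nsXL)) nVL.
have /andP[sXL _] := nsXL; have nsVX : V <| X := normalS sVX sXL nsVL.
have /is_abelemP[s s_pr /and3P[sV abV _]] := abelV.
have [S sylS nSY] := sol_coprime_Sylow_exists s solY nXY
  (Frobenius_coprime frobL).
have sVS : V \subset S.
  by rewrite (subset_trans (pcore_max sV nsVX)) ?(pcore_sub_Hall sylS).
pose Z1 := (V :&: 'Z(S))%G.
have cXZ1 : X \subset 'C(Z1).
  have nV_XY : X <*> Y \subset 'N(V) by rewrite join_subG !(subset_trans _ nVL).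
  apply: (Frobenius_p'_act_cent frobL _ _ _ _ abV sV nV_XY (subsetIl V 'Z(S))
    sylS) => //.
  by rewrite centsC subIset // subsetIr orbT.
have cXV : X \subset 'C(V).
  suffices /eqP : 'C_V(X) = V by rewrite centsC => /eqP/setIidPl.
  apply: minV'; rewrite ?subsetIl //; apply/andP; split; last first.
    by rewrite normsI // norms_cent // normal_norm.
  have ntZ1 : Z1 :!=: 1.
    by rewrite meet_center_nil ?(pgroup_nil (pHall_pgroup sylS)) //
      (normalS sVS (pHall_sub sylS)) // /normal sVS
      (subset_trans (pHall_sub sylS)) // normal_norm.
  by apply: subG1_contra ntZ1; rewrite subsetI subsetIl centsC.
have sVZ : V \subset 'Z(X) by rewrite subsetI sVX centsC.
have nilXV : nilpotent (X / V).
  have [/eqP XV1 | ntXV] := boolP (X / V == 1); first by rewrite XV1 nilpotent1.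
  have ltVX : V \proper X
    by rewrite properE sVX -quotient_sub1 ?subG1 //
    (subset_trans (normal_sub nsXL)).
  have frobLV : [Frobenius L / V = (X / V) ><| (Y / V)].
    apply: Frobenius_coprime_quotient; rewrite ?(Frobenius_coprime frobL) //.
    by split=> // y /(Frobenius_reg_ker frobL) ->; apply: sub1G.
  by apply: IHn frobLV _ _;
    rewrite ?quotient_sol // (leq_trans (ltn_quotient _ _)).
rewrite -quotient_center_nil;
  have /homgP[f <-] := homg_quotientS (subset_trans (normal_sub nsXL) nVL)
  (gFnorm _ X) sVZ.
exact: morphim_nil.
Qed.

(** * Fusion and transfer *)

(** Burnside's fusion argument: Q and Q :^ g both centralise x ^ g, and are
    therefore conjugate in the centraliser of x ^ g in N. *)
Lemma Sylow_center_fusion (gT : finGroupType) (N Q : {group gT}) (q : nat) x g :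
    q.-Sylow(N) Q -> g \in 'N(N) -> x \in 'Z(Q) -> x ^ g \in 'Z(Q) ->
  exists2 c, c \in 'C_N[x ^ g] & g * c \in 'N(Q).
Proof.
move=> sylQ nNg /setIP[Qx cQx] /setIP[Qxg cQxg]; have sQN := pHall_sub sylQ.
have sylC (P : {group gT}) : q.-Sylow(N) P -> x ^ g \in 'C(P) ->
  q.-Sylow('C_N[x ^ g]) P.
  move=> sylP cPxg; apply: (pHall_subl _ (subsetIl _ _) sylP).
  by rewrite subsetI (pHall_sub sylP) sub_cent1.
have [||c Cc defQ] := Sylow_trans (sylC (Q :^ g)%G _ _) (sylC Q sylQ cQxg).
- by rewrite -(normP nNg) pHallJ2.
- by rewrite /= centJ memJ_conjg.
by exists c => //; apply/normP; rewrite conjsgM -defQ.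
Qed.

(** Every factor of the transfer of x in Q is a conjugate of a power of x that
    lies in Q again. By fusion the conjugation is trivial, so that the transfer
    is x ^+ #|G : Q|, and the kernel of the transfer meets Q trivially. *)
Lemma Burnside_transfer (gT : finGroupType) (G Q : {group gT}) (q : nat) :
    q.-Sylow(G) Q -> 'N_G(Q) \subset 'C(Q) ->
  exists M : {group gT}, [/\ M <| G, abelian (G / M) & M :&: Q = 1].
Proof.
move=> sylQ cQN; have sQG := pHall_sub sylQ.
have abQ : abelian Q by apply: subset_trans cQN; rewrite subsetI sQG normG.
have ZQ : 'Z(Q) = Q by apply/center_idP.
have abA : abelian (idm Q @* Q) by rewrite morphim_idm.
pose tau : {morphism G >-> _} := transfer_morphism G abA.
have tauE x : x \in Q -> tau x = (fmod abA x *+ #|G : Q|)%R.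
  move=> Qx; have Gx := subsetP sQG x Qx.
  have trX := transversalP (rcosets_cycle_partition sQG Gx).
  rewrite [LHS](transfer_cycle_expansion sQG abA Gx trX).
  rewrite -(sum_index_rcosets_cycle sQG Gx trX) -sumrMnr.
  apply: eq_bigr => t Xt; have Gt := subsetP (transversal_sub trX) t Xt.
  have Ax : x \in idm Q @* Q by rewrite morphim_idm.
  rewrite /= -fmodX //; set n := indexg _ _.
  suffices -> : (x ^+ n) ^ t^-1 = x ^+ n by [].
  have Qxnt : (x ^+ n) ^ t^-1 \in Q.
    by have := mulg_exp_card_rcosets Q x t;
      rewrite mem_rcoset conjgE invgK mulgA.
  have := Sylow_center_fusion sylQ (subsetP (normG G) _ (groupVr Gt)).
  rewrite ZQ => /(_ (x ^+ n) (groupX n Qx) Qxnt)[c /setIP[Gc /cent1P cc] Nc].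
  have /(subsetP cQN)/centP cQtc : t^-1 * c \in 'N_G(Q)
    by rewrite inE groupM ?groupV.
  have /commgP/conjg_fixP <- : commute ((x ^+ n) ^ t^-1) c by [].
  by rewrite -conjgM; apply/conjg_fixP/commgP;
    apply/esym/(cQtc _ (groupX n Qx)).
exists ('ker tau)%G; split; first exact: ker_normal.
  rewrite /= (isog_abelian (first_isog _)).
  by apply/centsP=> u _ v _; apply: addrC.
apply/trivgP/subsetP=> x /setIP[/mker tx Qx].
have co_Q : coprime #|Q| #|G : Q| by have /andP[] := pHall_Hall sylQ.
have Ax y : y \in Q -> y \in idm Q @* Q by rewrite morphim_idm.
have: fmod abA (x ^+ #|G : Q|) = 0%R.
  by rewrite fmodX ?Ax // -tauE // tx.
move/(congr1 val); rewrite fmodK ?Ax ?groupX // => xn1.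
by apply/set1P/(can_in_inj (expgK co_Q)) => //=; rewrite expg1n.
Qed.

(** * Frobenius complements and kernels of odd order *)

Lemma Sylow_neq1 (gT : finGroupType) (G Q : {group gT}) (q : nat) :
  q.-Sylow(G) Q -> prime q -> q %| #|G| -> Q :!=: 1.
Proof.
move=> sylQ q_pr q_dv; rewrite -rank_gt0 (rank_Sylow sylQ) p_rank_gt0.
by rewrite mem_primes q_pr cardG_gt0.
Qed.

(** E acts on a minimal E-invariant subgroup V of an invariant Sylow subgroup
    of N. This action is irreducible, and it is faithful because E acts freely.
    An abelian group with a faithful irreducible representation is cyclic. *)
Lemma abelian_semiregular_cyclic (gT : finGroupType) (N E : {group gT}) :
    abelian E -> E \subset 'N(N) -> N :!=: 1 -> semiregular N E -> cyclic E.
Proof.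
move=> abE nNE ntN regE; have coNE := regular_norm_coprime nNE regE.
have [q q_pr q_dv] := pdivP (etrans (cardG_gt1 N) ntN).
have [Q sylQ nQE] := sol_coprime_Sylow_exists q (abelian_sol abE) nNE coNE.
have ntQ : Q :!=: 1 := Sylow_neq1 sylQ q_pr q_dv.
have [V minV sVQ] := minnormal_exists ntQ nQE.
have solQ : solvable Q := pgroup_sol (pHall_pgroup sylQ).
have [nVE ntV abelV] := minnormal_solvable minV sVQ solQ.
have [q' _ abelqV] := is_abelemP abelV.
have sVN := subset_trans sVQ (pHall_sub sylQ).
have ffulE : mx_faithful (abelem_repr abelqV ntV nVE).
  apply: abelem_mx_faithful; apply/trivgP/subsetP=> e /setIP[Ee cVe];
    apply: contraR ntV => nte.
  rewrite -subG1; apply: (@subset_trans _ _ 'C_N[e]).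
    by rewrite subsetI sVN sub_cent1.
  by rewrite regE // inE nte.
have irrE : mx_irreducible (abelem_repr abelqV ntV nVE) by apply/abelem_mx_irrP.
exact: mx_faithful_irr_abelian_cyclic ffulE irrE abE.
Qed.

(** A non-cyclic group of odd prime power order contains an elementary abelian
    subgroup of rank 2, which cannot act freely on N. *)
Lemma Frobenius_compl_Zgroup (gT : finGroupType) (K N H : {group gT}) :
  [Frobenius K = N ><| H] -> odd #|H| -> Zgroup H.
Proof.
move=> frobK oddH; apply/forall_inP=> P /SylowP[p p_pr sylP].
have [defK ntN _ _ _] := Frobenius_context frobK;
  have [_ _ nNH _] := sdprodP defK.
have [sPH pP _] := and3P sylP.
rewrite (odd_pgroup_rank1_cyclic pP (oddSg sPH oddH)) leqNgt.
apply/p_rank_geP=> [[E /pnElemP[sEP abelE logE]]].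
have sEH := subset_trans sEP sPH.
have: cyclic E.
  apply: abelian_semiregular_cyclic (abelem_abelian abelE)
    (subset_trans sEH nNH) ntN _.
  exact: semiregularS (subxx N) sEH (Frobenius_reg_ker frobK).
by rewrite (abelem_cyclic abelE) logE.
Qed.

(** Nilpotent groups with cyclic Sylow subgroups are cyclic, and
    Frobenius_sol_kernel_nil reduces nilpotence to solvability. To see that X
    is solvable, take an invariant Sylow subgroup Q. It is abelian and central
    in its normaliser, so the transfer gives that X^`(1) is a proper subgroup.
    Now X^`(1) is again a Frobenius kernel, and induction applies. *)
Lemma Frobenius_ker_Zgroup_cyclic (gT : finGroupType) (L X Y : {group gT}) :
  [Frobenius L = X ><| Y] -> Zgroup X -> cyclic X.
Proof.
move=> frobL ZX.
(* A subgroup of Y of prime order can take the place of Y. *)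
wlog solY : L Y frobL / solvable Y.
  have [defL _ ntY _ _] := Frobenius_context frobL.
  have [r r_pr] := pdivP (etrans (cardG_gt1 Y) ntY) => /(Cauchy r_pr)[y Yy oy].
  apply; first apply: Frobenius_subr frobL;
    last exact: (abelian_sol (cycle_abelian y)).
    by rewrite cycle_eq1 -order_gt1 oy prime_gt1.
  by rewrite cycle_subG.
suffices solX : solvable X.
  exact: nil_Zgroup_cyclic ZX (Frobenius_sol_kernel_nil frobL solY solX).
have [n] := ubnP #|X|; elim: n => // n IHn in L X frobL ZX * => /ltnSE-leXn.
have [defL ntX _ _ _] := Frobenius_context frobL;
  have [_ _ nXY _] := sdprodP defL.
have [q q_pr q_dv] := pdivP (etrans (cardG_gt1 X) ntX).
have [Q sylQ nQY] := sol_coprime_Sylow_exists q solY nXY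
  (Frobenius_coprime frobL).
have ntQ : Q :!=: 1 := Sylow_neq1 sylQ q_pr q_dv.
have abQ : abelian Q.
  by apply: cyclic_abelian; apply: (forall_inP ZX); apply/SylowP; exists q.
have := Frobenius_norm_Sylow_cent frobL solY sylQ nQY; rewrite (center_idP abQ).
case/(Burnside_transfer sylQ)=> M [nsMX abXM tiMQ].
have sX'M : X^`(1) \subset M by rewrite der1_min ?normal_norm.
rewrite (series_sol (der_normal 1 X)) andbC (abelian_sol (der_abelian 0 X)) /=.
have [X'1 | ntX'] := eqVneq X^`(1) 1; first by rewrite X'1 solvable1.
apply: (IHn _ X^`(1)%G (Frobenius_subl ntX' (der_sub 1 X) _ frobL)
  (ZgroupS (der_sub 1 X) ZX)).
  exact: char_norm_trans (der_char 1 X) nXY.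
apply: leq_trans leXn; rewrite proper_card // properEneq der_sub andbT.
apply: contraNneq ntQ => defX'; rewrite -subG1 -tiMQ subsetI subxx andbT.
by rewrite (subset_trans (pHall_sub sylQ)) // -{1}defX'.
Qed.

(** * The structure of 2-Frobenius groups *)

(** An involution of K acts on N without fixed points, and therefore inverts
    every element of N. Thus two involutions of K differ by an element that
    centralises N, and such elements lie in N. If K / N had even order, it
    would have a single involution, which would be central in G / N; but
    elements other than 1 of the kernel K / N have their centralisers inside
    K/N. *)
Lemma two_Frobenius_ker_odd (gT : finGroupType) (G N K : {group gT}) :
    N <| G -> K <| G -> N \subset K -> [Frobenius K with kernel N] ->
  [Frobenius G / N with kernel K / N] -> odd #|K / N|.
Proof.
move=> nsNG nsKG sNK frobK frobGN.
have [ntN _ nsNK regN] := Frobenius_kerP frobK.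
have [_ ltKGN _ regKN] := Frobenius_kerP frobGN.
have coNK := Frobenius_ker_coprime frobK.
apply: contraR (proper_subn ltKGN); rewrite -dvdn2 => dv2.
have [t' Kt' ot'] := Cauchy (isT : prime 2) dv2.
have oddN : odd #|N|.
  rewrite -coprime2n coprime_sym; apply: coprime_dvdr coNK.
  by rewrite -card_quotient ?normal_norm.
have [t Kt ot] := Cauchy (isT : prime 2) (dvdn_trans dv2 (dvdn_quotient K N)).
have notN (s : gT) : #[s] = 2 -> s \notin N.
  by move=> os; apply/negP=> /order_dvdG; rewrite os dvdn2 oddN.
have inv (s : gT) : s \in K -> #[s] = 2 -> {in N, forall x, x ^ s = x^-1}.
  move=> Ks os; have nNs : s \in 'N(N) by rewrite (subsetP (normal_norm nsNK)).
  have s2 : s * s = 1 by rewrite -expg2 -os expg_order.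
  (* As s has no fixed points in N, the map f is a bijection of N, and s
     inverts all its values. *)
  pose f x := x^-1 * x ^ s.
  have injf : {in N &, injective f}.
    move=> x y Nx Ny /= Dfxy; apply/eqP; rewrite eq_mulgV1.
    apply: contraR (notN s os) => ntz; apply: (subsetP (regN (x * y^-1) _)).
      by rewrite !inE ntz groupM ?groupV.
    rewrite inE Ks; apply/cent1P/esym/commgP/conjg_fixP.
    have Dxs : x ^ s = x * (y^-1 * y ^ s)
      by rewrite -[RHS]/(x * f y) -Dfxy mulKVg.
    by rewrite conjMg conjVg Dxs mulgA mulgK.
  have defN : f @: N = N.
    apply/eqP; rewrite eqEcard card_in_imset // leqnn andbT.
    by apply/subsetP=> _ /imsetP[x Nx ->]; rewrite groupM ?groupV ?memJ_norm.
  move=> x; rewrite -{1}defN => /imsetP[y Ny ->].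
  by rewrite /f conjMg conjVg -conjgM s2 conjg1 [RHS]invMg invgK.
have sGC : G / N \subset 'C[coset N t].
  apply/subsetP=> _ /morphimP[g nNg Gg ->]; apply/cent1P/esym/commgP/conjg_fixP.
  have nNt : t \in 'N(N) by rewrite (subsetP (normal_norm nsNK)).
  rewrite -morphJ //; apply/rcoset_kercosetP; rewrite ?groupJ // mem_rcoset.
  have Ktg : t ^ g \in K by rewrite memJ_norm // (subsetP (normal_norm nsKG)).
  have [n Nn ntn] := trivgPn _ ntN; apply: (subsetP (regN n _)).
    by rewrite !inE ntn.
  rewrite inE groupM ?groupV //=; apply/cent1P/esym/commgP/conjg_fixP.
  have tV : t^-1 = t by apply/eqP; rewrite eq_invg_mul -expg2 -ot expg_order.
  by rewrite conjgM tV (inv (t ^ g)) ?orderJ // (inv t) ?groupV ?invgK.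
apply: subset_trans (regKN (coset N t) _); first by rewrite subsetI subxx.
rewrite !inE mem_quotient // andbT; apply/eqP=> /coset_idr.
by rewrite (subsetP (normal_norm nsNK)) // => /(_ isT); apply/negP/notN.
Qed.

(** K / N has odd order and is a Frobenius complement as well as a Frobenius
    kernel, so it is cyclic. By the theorem of Schur and Zassenhaus all
    complements of N in K are conjugate under N, so that G = N * 'N_G(H) for
    any complement H. Since 'C_N(H) = 1, this normaliser meets N trivially; it
    is a copy of G / N inside G. *)
Lemma two_Frobenius_structure (gT : finGroupType) (G : {group gT}) :
    two_Frobenius G ->
  exists N H C : {group gT},
    [/\ N ><| (H <*> C) = G, [Frobenius N <*> H = N ><| H],
        [Frobenius H <*> C = H ><| C], cyclic H & odd #|H|].
Proof.
case=> N [K [nsNG nsKG sNK frobK frobGN]].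
have oddKN := two_Frobenius_ker_odd nsNG nsKG sNK frobK frobGN.
have [nNG nKG] := (normal_norm nsNG, normal_norm nsKG).
have [sNG sKG] := (normal_sub nsNG, normal_sub nsKG).
have [H frobKH] := existsP frobK.
have [defK ntN ntH _ _] := Frobenius_context frobKH.
have [nsNK sHK mulNH nNH tiNH] := sdprod_context defK.
have coNH := Frobenius_coprime frobKH.
have isoH : H \isog K / N by rewrite -mulNH quotientMidl quotient_isog.
have oddH : odd #|H| by rewrite (card_isog isoH).
have cycH : cyclic H.
  have [Y frobY] := existsP frobGN; rewrite (isog_cyclic isoH).
  apply: Frobenius_ker_Zgroup_cyclic frobY _.
  have [f injf <-] := isogP isoH.
  exact/morphim_Zgroup/(Frobenius_compl_Zgroup frobKH oddH).
have sHG := subset_trans sHK sKG.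
pose B := 'N_G(H)%G.
have tiNB : N :&: B = 1.
  have nNN : H \subset 'N(N) by [].
  rewrite setIA (setIidPl sNG) (coprime_norm_cent nNH coNH).
  exact: Frobenius_trivg_cent frobKH.
have nNB : B \subset 'N(N) by rewrite subIset ?nNG.
have mulNB : N * B = G.
  apply/eqP; rewrite eqEsubset mul_subG ?subsetIl //=; apply/subsetP=> g Gg.
  have [|x Nx Dx] := SchurZassenhaus_trans_actsol
    (abelian_sol (cyclic_abelian cycH)) nNH _ coNH (esym (cardJg H g)).
    rewrite joingC -(sdprodEY nNH tiNH) defK.
    by rewrite -(normP (subsetP nKG g Gg)) conjSg.
  have Gx := subsetP sNG x Nx.
  rewrite -(normC nNB) -(mulgKV x g) mem_mulg // inE groupM ?groupV //.
  by apply/normP; rewrite conjsgM Dx conjsgK.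
have sHB : H \subset B by rewrite subsetI sHG normG.
have frobB : [Frobenius B with kernel H].
  have [_ ltK _ regK] := Frobenius_kerP frobGN.
  apply/Frobenius_kerP; split=> //.
  - rewrite properE sHB; apply: contra (proper_subn ltK) => sBH.
    by rewrite quotientS // -mulNB -mulNH mulgS.
  - by rewrite /normal sHB subsetIr.
  move=> h /setD1P[nth Hh]; apply/subsetP=> b /setIP[Bb cbh].
  have Kb : coset N b \in K / N.
    apply: (subsetP (regK (coset N h) _)).
      rewrite !inE mem_quotient ?(subsetP sHK) // andbT.
      by apply: contra nth => /eqP/(coset_idr (subsetP nNH h Hh)) Nh;
        rewrite -in_set1 -[[set 1]]tiNH inE Nh.
    have /setIP[Gb _] := Bb; rewrite inE mem_quotient //= cent1C.
    apply/cent1P; rewrite /commute -!morphM ?(subsetP nNB) // ?(subsetP sHB) //.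
    by rewrite (cent1P cbh).
  have Kb' : b \in K.
    have /morphimP[k nNk Kk Dbk] := Kb.
    have /rcosetP[n Nn ->] : b \in N :* k by apply/rcoset_kercosetP=> //;
      apply: subsetP Bb.
    by rewrite groupMr // (subsetP sNK).
  have : b \in H * N :&: B by rewrite inE Bb andbT (normC nNH) mulNH.
  by rewrite -group_modl // tiNB mulg1.
have [C frobHC] := existsP frobB.
have [defB _ _ _ _] := Frobenius_context frobHC.
have [_ _ _ nHC _] := sdprod_context defB.
have {}defB : H <*> C = B by rewrite norm_joinEr ?(sdprodW defB).
exists N, H, C; rewrite defB frobHC cycH oddH; split=> //.
  by rewrite sdprodE.
by rewrite -(sdprodEY nNH tiNH) defK.
Qed.

(** * 2-Frobenius groups with quadratic character values *)

(** The values at a generator of the #|C| linear characters of C are distinct,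
    so that they are all the roots of unity of order #|C|. *)
Lemma cyclic_prim_root_char (gT : finGroupType) (C : {group gT}) (c : gT) :
  C :=: <[c]> -> exists i : Iirr C, (#|C|.-primitive_root ('chi_i c))%R.
Proof.
move/group_inj->; rewrite -orderE.
have cycC := cycle_cyclic c;
  have [z prim_z] := C_prim_root_exists (order_gt0 c).
have lin i : ('chi[<[c]>]_i)%R \is a linear_char by apply: irr_cyclic_lin.
have val i : exists k : 'I_#[c], ('chi[<[c]>]_i c = z ^+ k)%R.
  have [|k ->] := prim_rootP prim_z (x := ('chi[<[c]>]_i c)%R);
    last by exists k.
  by rewrite -lin_charX ?cycle_id // expg_order lin_char1.
have /fin_all_exists[f Df] := val.
have injf : injective f.
  move=> i j Dfij; apply: irr_inj; apply/cfun_inP=> _ /cycleP[k ->].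
  by rewrite !lin_charX ?cycle_id // !Df Dfij.
have [|g gK fK] := inj_card_bij injf;
  first by rewrite card_ord card_Iirr_cyclic.
have [c1 | c_gt1] := leqP #[c] 1.
  have {}c1 : #[c] = 1%N by apply/eqP; rewrite eqn_leq c1 order_gt0.
  exists 0%R; rewrite irr0 cfun1E cycle_id
    -[X in (_.-primitive_root X)%R](prim_expr_order prim_z).
  by rewrite c1 expr1 -c1.
exists (g (Ordinal c_gt1)); by rewrite Df fK /= expr1.
Qed.

(** Among 2, m/2 - 1 and m/2 - 2 there is for m > 6 a number prime to m: 2 if m
    is odd, and otherwise the odd one of the other two. *)
Lemma unit_group_pm1_cases m : 1 < m ->
    (forall k, coprime k m -> (k == 1 %[mod m]) || (k == m.-1 %[mod m])) ->
  m \in [:: 2; 3; 4; 6].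
Proof.
move=> m_gt1 pm1; have small k : 1 < k -> k < m.-1 -> ~~ coprime k m.
  move=> k_gt1 lt_km; apply/negP=> /pm1;
    have lt_km' := leq_trans lt_km (leq_pred m).
  by rewrite !modn_small ?prednK ?(ltnW m_gt1) // (gtn_eqF k_gt1)
    (ltn_eqF lt_km).
have [m_le6 | m_gt6] := leqP m 6.
  case: m m_gt1 m_le6 small {pm1} => [|[|[|[|[|[|[|]]]]]]] //= _ _ small.
  by have := small 2 isT isT.
have := odd_double_half m; case: (boolP (odd m)) => [m_odd _ | _ Dm].
  have lt2 : 2 < m.-1 by rewrite -ltnS prednK ?(ltnW m_gt1) //
    (leq_trans _ m_gt6).
  by have := small 2 isT lt2; rewrite coprime2n m_odd.
(* From here on m = 2 (b + 4). *)
rewrite add0n in Dm; case: m./2 Dm => [|[|[|[|b]]]] Dm;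
  rewrite -Dm // in m_gt6 small.
have lt_b : b.+3 < b.+4.*2.-1 by rewrite doubleS /= ltnS -addnn; lia.
have [b_odd | b_even] := boolP (odd b).
  have /negP[] := small b.+2 isT (ltnW lt_b).
  rewrite -muln2 coprimeMr coprimen2 /= negbK b_odd andbT.
  by rewrite -[X in coprime _ X]addn2 /coprime gcdnDl -/(coprime _ _) coprimen2
    /= negbK.
have /negP[] := small b.+3 isT lt_b.
by rewrite -muln2 coprimeMr coprimenS coprimen2 /= negbK.
Qed.

(** By two_Frobenius_structure, the following hypotheses describe any 2-Frobenius
    group; N is called its lower kernel and H its upper kernel. *)
Section TwoFrobenius.

Variables (gT : finGroupType) (G N H C : {group gT}).
Hypothesis defG : N ><| (H <*> C) = G.
Hypothesis frobNH : [Frobenius N <*> H = N ><| H].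
Hypothesis frobHC : [Frobenius H <*> C = H ><| C].
Hypotheses (cycH : cyclic H) (oddH : odd #|H|).
Hypothesis quadG : character_quadratic G \/ semi_rational G.

Let B := (H <*> C)%G.
Let nsNG : N <| G. Proof. by have [] := sdprod_context defG. Qed.
Let sBG : B \subset G. Proof. by have [] := sdprod_context defG. Qed.
Let mulNB : N * B = G. Proof. by have [] := sdprod_context defG. Qed.
Let nNB : B \subset 'N(N). Proof. by have [] := sdprod_context defG. Qed.
Let tiNB : N :&: B = 1. Proof. by have [] := sdprod_context defG. Qed.
Let defB : H ><| C = B. Proof. by have [] := Frobenius_context frobHC. Qed.
Let sHB : H \subset B. Proof. by have /sdprod_context[/andP[]] := defB. Qed.
Let sCB : C \subset B. Proof. by have /sdprod_context[] := defB. Qed.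
Let mulHC : H * C = B. Proof. by have /sdprod_context[] := defB. Qed.
Let nHC : C \subset 'N(H). Proof. by have /sdprod_context[] := defB. Qed.
Let tiHC : H :&: C = 1. Proof. by have /sdprod_context[] := defB. Qed.
Let sHG : H \subset G := subset_trans sHB sBG.
Let sCG : C \subset G := subset_trans sCB sBG.

(** For elements of H, conjugacy in G is conjugacy under C, because N has
    trivial intersection with H <*> C and H is abelian. *)
Lemma upper_ker_sqr_conj h k : h \in H -> coprime k #[h] ->
  exists2 c, c \in C & h ^ c = h ^+ (k * k).
Proof.
move=> Hh co_kh.
have /imsetP[g] := quadratic_sqr_conj quadG (subsetP sHG h Hh) co_kh.
rewrite -mulNB => /mulsgP[n b Nn Bb ->] Dhk; have nNb := subsetP nNB b Bb.
have: b \in H * C by rewrite mulHC.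
case/mulsgP=> h' c Hh' Cc Db; exists c => //.
have Dhb : h ^ b = h ^ c.
  rewrite Db conjgM; congr (_ ^ c); apply/conjg_fixP/commgP.
  exact: (centsP (cyclic_abelian cycH)).
apply/eqP; rewrite -Dhb eq_mulVg1 -in_set1 -[[set 1]]tiNB inE; apply/andP;
  split; last first.
  by rewrite groupM ?groupV ?groupX ?groupJ // (subsetP sHB).
rewrite Dhk conjgM -conjVg -conjMg memJ_norm //.
by rewrite -commgEl commgEr groupM ?memJ_norm ?groupV // (subsetP nNB)
  ?(subsetP sHB).
Qed.

(** The element c of C that takes a generator h of H to h ^+ (k * k) fixes the
    elements of order r if k * k = 1 modulo r. As C acts freely on H, this
    forces c = 1 and k * k = 1 modulo the order of H. *)
Lemma upper_ker_sqr_mod_dvd k r : coprime k #|H| -> r %| #|H| -> 1 < r ->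
  r %| (k * k).-1 -> #|H| %| (k * k).-1.
Proof.
have [h defH] := cyclicP cycH; move=> co_k r_dv r_gt1 r_dv_k.
have Hh : h \in H by rewrite defH cycle_id.
have oh : #[h] = #|H| by rewrite defH.
have k_gt0 : 0 < k.
  by case: k co_k {r_dv_k} => //; rewrite /coprime gcd0n => /eqP n1;
    rewrite n1 dvdn1 in r_dv; rewrite (eqP r_dv) in r_gt1.
have expk y : (y ^+ (k * k) == y) = (#[y] %| (k * k).-1).
  by rewrite order_dvdn -[RHS](inj_eq (mulIg y)) mul1g -expgSr prednK ?muln_gt0
    ?k_gt0.
have [|c Cc Dhc] := upper_ker_sqr_conj Hh (k := k); first by rewrite oh.
rewrite -oh -expk -Dhc; pose y := h ^+ (#|H| %/ r).
have oy : #[y] = r by rewrite orderXdiv oh ?dvdn_div // divnA // mulKn //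
  cardG_gt0.
suffices -> : c = 1 by rewrite conjg1.
apply/eqP; apply: contraTT r_gt1 => ntc; rewrite -oy order_gt1 negbK -in_set1.
have regc : 'C_H[c] = 1 by apply: (Frobenius_reg_ker frobHC); rewrite !inE ntc.
rewrite -[[set 1]]regc inE groupX //=.
by apply/cent1P/commgP/conjg_fixP; rewrite conjXg Dhc -expgM mulnC expgM;
  apply/eqP; rewrite expk oy.
Qed.

(** Let r be a prime divisor of n = #|H| and s = n / r > 1. If r divides s,
    then k = s + 1 has k^2 = 1 modulo r but not modulo n, since k^2 - 1 =
    s(s+2). Otherwise, k = 1 modulo one of r and s together with k = 2 modulo
    the other one shows that both r and s divide 2^2 - 1 = 3, which is absurd
    for coprime numbers greater than 1. *)
Lemma upper_ker_prime : prime #|H|.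
Proof.
have n_gt1 : 1 < #|H| by rewrite cardG_gt1; have [] := Frobenius_context frobHC.
have [r r_pr r_dv] := pdivP n_gt1; have [s Dn] := dvdnP r_dv.
have [s1 | s_gt1] := leqP s 1.
  have /eqP s_eq1 : s == 1%N.
    by rewrite eqn_leq s1 lt0n; apply: contraTneq n_gt1 => s0; rewrite Dn s0.
  by rewrite Dn s_eq1 mul1n.
have r_gt1 := prime_gt1 r_pr.
have [odd_r odd_s] : odd r /\ odd s by move: oddH; rewrite Dn oddM => /andP[].
have r_odd3 : 2 < r by case: r r_gt1 odd_r {r_pr r_dv Dn} => [|[|[|]]].
have [r_dv_s | r_ndv_s] := boolP (r %| s).
  have co_k : coprime s.+1 #|H|.
    have co_s : coprime s.+1 s by rewrite coprimeSn.
    by rewrite Dn coprimeMr co_s (coprime_dvdr r_dv_s co_s).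
  have := upper_ker_sqr_mod_dvd co_k r_dv r_gt1; rewrite mulnS addSn /=.
  have ->: (s + s.+1 * s = s * s.+2)%N by rewrite mulSn !mulnS.
  rewrite dvdn_mulr // => /(_ isT); rewrite Dn dvdn_pmul2l ?(ltnW s_gt1) //.
  by rewrite -addn2 dvdn_addr // => /(dvdn_leq (isT : 0 < 2));
    rewrite leqNgt r_odd3.
have co_rs : coprime r s by rewrite prime_coprime.
have dvd3 a b : #|H| = (a * b)%N -> coprime a b -> 1 < a -> odd b -> b %| 3.
  (* This k is 1 modulo a and 2 modulo b. *)
  move=> Dab co_ab a_gt1 odd_b; pose k := chinese a b 1 2.
  have k1 : k = 1 %[mod a] by rewrite chinese_modl.
  have k2 : k = 2 %[mod b] by rewrite chinese_modr.
  have co_k : coprime k #|H|.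
    rewrite Dab coprimeMr -coprime_modl k1 coprime_modl coprime1n.
    by rewrite -coprime_modl k2 coprime_modl coprime2n.
  have k_gt0 : 0 < k.
    by rewrite lt0n; apply: contraTneq co_k => ->;
      rewrite /coprime gcd0n neq_ltn n_gt1 orbT.
  have kk : (k * k).-1 = (k * k - 1)%N by rewrite subn1.
  have a_dv : a %| #|H| by rewrite Dab dvdn_mulr.
  have := upper_ker_sqr_mod_dvd co_k a_dv a_gt1;
    rewrite kk -eqn_mod_dvd ?muln_gt0 ?k_gt0 //.
  rewrite -modnMm k1 modnMm eqxx => /(_ isT); rewrite Dab => b_dv.
  have {b_dv}: b %| k * k - 1 by rewrite (dvdn_trans _ b_dv) ?dvdn_mull.
  rewrite -eqn_mod_dvd ?muln_gt0 ?k_gt0 // -modnMm k2 modnMm.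
  by rewrite eqn_mod_dvd.
have co_sr : coprime s r by rewrite coprime_sym.
have s3 := dvd3 r s (etrans Dn (mulnC s r)) co_rs r_gt1 odd_s.
have := dvd3 s r Dn co_sr s_gt1 odd_r => r3.
have /(prime_nt_dvdP (isT : prime 3)) /(_ s3) Ds : s != 1%N by rewrite gtn_eqF.
have /(prime_nt_dvdP (isT : prime 3)) /(_ r3) Dr : r != 1%N by rewrite gtn_eqF.
by rewrite Dr Ds in co_rs.
Qed.

(** C acts faithfully on the group H of prime order, and the automorphism group
    of such a group is cyclic. *)
Lemma compl_cyclic : cyclic C.
Proof.
have injC : 'injm (restrm nHC (conj_aut H)).
  rewrite ker_restrm ker_conj_aut; apply/subsetP=> c /setIP[Cc cHc].
  apply/set1P/eqP; apply: contraTT (prime_gt1 upper_ker_prime) => ntc.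
  have regc : 'C_H[c] = 1 by apply: (Frobenius_reg_ker frobHC);
    rewrite !inE ntc.
  rewrite -(setIidPl (_ : H \subset 'C[c])) ?regc ?cards1 //.
  by rewrite sub_cent1.
rewrite -(injm_cyclic injC) //;
  apply: cyclicS (Aut_prime_cyclic upper_ker_prime).
by rewrite /= morphim_restrm setIid Aut_conj_aut.
Qed.

(** A single orbit of C on H contains all h ^+ (i * i), and there are (p-1)/2
    non-zero squares modulo p = #|H|. *)
Lemma upper_ker_card_le : #|H|.-1 <= #|C|.*2.
Proof.
have p_pr := upper_ker_prime; have [h defH] := cyclicP cycH.
have Hh : h \in H by rewrite defH cycle_id.
have oh : #[h] = #|H| by rewrite defH.
set p := #|H| in p_pr oh *; pose n := p.-1./2.
have Dp : p = n.*2.+1.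
  have := odd_double_half p.-1;
    rewrite -[odd _]negbK -oddS prednK ?prime_gt0 // oddH /= add0n => ->.
  by rewrite prednK ?prime_gt0.
rewrite -/p Dp /= leq_double.
pose f (i : 'I_n) := h ^+ (i.+1 * i.+1)%N.
have injf : injective f.
  move=> i j /eqP; rewrite eq_expg_mod_order oh.
  wlog le_ij : i j / i <= j.
    move=> IH eq_ij; have [/IH|/ltnW/IH IHj] := leqP i j; first exact.
    by apply/esym/IHj; rewrite eq_sym.
  rewrite eq_sym eqn_mod_dvd ?leq_mul // => p_dv; apply: val_inj => /=.
  have lt_jn := ltn_ord j.
  move: p_dv; rewrite !mulnn subn_sqr Euclid_dvdM // subSS Dp.
  have sum_gt0 : 0 < j.+1 + i.+1 by rewrite addn_gt0.
  case/orP=> [|/(dvdn_leq sum_gt0)]; last by rewrite ltnNge -addnn leq_add.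
  have [ji0 _ | ji_gt0 /(dvdn_leq ji_gt0)] := posnP (j - i).
    by apply/eqP; rewrite eqn_leq le_ij -subn_eq0 ji0.
  by rewrite leqNgt ltnS (leq_trans (leq_subr _ _)) //
    (leq_trans (ltnW lt_jn)) // -addnn leq_addr.
rewrite -[X in X <= _](card_ord n) -(card_imset _ injf).
apply: (@leq_trans #|h ^: C|).
  apply/subset_leq_card/subsetP=> _ /imsetP[i _ ->].
  have [|c Cc Dhc] := upper_ker_sqr_conj Hh (k := i.+1);
    last by rewrite /f -[_ ^+ _]Dhc imset_f.
  rewrite oh coprime_sym prime_coprime //; apply/negP=> /(dvdn_leq (ltn0Sn i)).
  by rewrite Dp ltnNge (leq_trans (ltn_ord i)) // -addnn leq_addr.
by rewrite -index_cent1 dvdn_leq ?dvdn_indexg.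
Qed.

Lemma upper_ker_card_dvd : #|C| %| #|H|.-1.
Proof. exact: Frobenius_dvd_ker1 frobHC. Qed.

(** C is the quotient of G by N <*> H, so that the characters of C can be
    inflated to G. *)
Lemma compl_lin_char : exists c (j : Iirr G),
  [/\ C :=: <[c]>, ('chi_j \is a linear_char)%R,
    (#|C|.-primitive_root ('chi_j c))%R
    & {in N, forall n, 'chi_j (n * c)%g = 'chi_j c}%R].
Proof.
pose K := (N <*> H)%G; have [defK _ _ _ _] := Frobenius_context frobNH.
have mulKC : K * C = G.
  by rewrite /= norm_joinEr ?(subset_trans sHB) // -mulgA mulHC mulNB.
have defG' : K ><| C = G.
  have nKC : C \subset 'N(K) by rewrite normsY // (subset_trans sCB nNB).
  rewrite sdprodE //; apply: card1_trivg; apply/eqP => /=.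
  have := mul_cardG K C;
    rewrite mulKC -(sdprod_card defG) -(sdprod_card defB) -(sdprod_card defK).
  by rewrite mulnA => /eqP;
    rewrite -[X in X == _]muln1 eqn_pmul2l ?muln_gt0 ?cardG_gt0 // eq_sym.
have [c defC] := cyclicP compl_cyclic; have Cc : c \in C
  by rewrite defC cycle_id.
have [i prim_z] := cyclic_prim_root_char defC.
have /irrP[j Dj] : cfSdprod defG' ('chi_i)%R \in irr G
  by rewrite cfSdprod_irr mem_irr.
exists c, j; split=> //; rewrite -?Dj ?cfSdprodEr //.
  by rewrite cfSdprod_lin_char irr_cyclic_lin ?compl_cyclic.
by move=> n Nn; rewrite (cfSdprodE defG') // (subsetP (joing_subl N H)).
Qed.

(** A primitive root of unity of order #|C| occurs as the value of an
    irreducible character. Since it has degree at most 2, no power automorphism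
    differs both from the identity and from inversion. *)
Lemma compl_card : #|C| \in [:: 2; 3; 4; 6].
Proof.
apply: unit_group_pm1_cases => [|k co_km].
  by rewrite cardG_gt1; have [] := Frobenius_context frobHC.
have [c [j [defC _ prim_z _]]] := compl_lin_char;
  set z := ('chi_j c)%R in prim_z.
have Cc : c \in C by rewrite defC cycle_id.
have [s sz dim_s] : exists2 s, z \in s & Qdegree s <= 2.
  have Gc := subsetP sCG c Cc.
  case: quadG => [/(_ j)|/(_ c Gc)] quad; eexists; try exact: quad.
    by apply: image_f.
  by apply: image_f.
have co_m1 : coprime #|C|.-1 #|C| by rewrite coprimePn.
have [nu1 nu1E] := Qn_aut_exists co_km; have [nu2 nu2E] := Qn_aut_exists co_m1.
have zm := prim_expr_order prim_z.
have m_gt0 := cardG_gt0 C.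
have [/(_ z sz)|/(_ z sz)|/(_ z sz)] := Qdegree_le2_aut nu1 nu2 dim_s.
- by rewrite nu1E // -{2}[z]expr1 => /eqP;
    rewrite (eq_prim_root_expr prim_z) => ->.
- rewrite nu2E // -{2}[z]expr1 => /eqP; rewrite (eq_prim_root_expr prim_z).
  case: #|C| m_gt0 co_km => [|[|[|m]]] // _; first by rewrite !modn1.
    by rewrite coprimen2 !modn2 => ->.
  by move=> _; rewrite (modn_small (ltnSn m.+2)) (modn_small (isT : 1 < m.+3)).
rewrite nu1E // nu2E // => /eqP; rewrite (eq_prim_root_expr prim_z) => ->.
by rewrite orbT.
Qed.

Let nNH : H \subset 'N(N) := subset_trans sHB nNB.
Let coNH : coprime #|N| #|H| := Frobenius_coprime frobNH.
Let solH : solvable H := abelian_sol (cyclic_abelian cycH).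
Let regNH : 'C_N(H) = 1 := Frobenius_trivg_cent frobNH.

(** Let c in C be different from 1. As c fixes v, the elements h and h ^ c act
    on v in the same way. Then h ^ c = h because H acts freely on N, and h = 1
    because C acts freely on H. *)
Lemma upper_ker_power_fix v h j :
  v \in 'C_N(C) -> v != 1 -> h \in H -> v ^ h = v ^+ j -> h = 1.
Proof.
move=> /setIP[Nv cCv] ntv Hh Dvh.
have [_ _ /trivgPn[c Cc ntc] _ _] := Frobenius_context frobHC.
have fixv : v ^ c = v by apply/conjg_fixP/commgP/(centP cCv).
have Hhc : h ^ c \in H by rewrite memJ_norm // (subsetP nHC).
have vhc : v ^ (h ^ c) = v ^+ j by rewrite -{1}fixv -conjJg Dvh conjXg fixv.
have Dhc : h ^ c = h.
  apply/eqP; rewrite eq_mulgV1; apply: contraR ntv => nth.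
  rewrite -in_set1 -[[set 1]](Frobenius_reg_ker frobNH (x := h ^ c * h^-1)).
    rewrite inE Nv; apply/cent1P/commgP/conjg_fixP.
    by rewrite conjgM vhc -Dvh conjgK.
  by rewrite !inE nth groupM ?groupV.
apply/eqP; rewrite -in_set1 -[[set 1]](Frobenius_reg_ker frobHC (x := c)).
  by rewrite inE Hh; apply/cent1P/commgP/conjg_fixP.
by rewrite !inE ntc.
Qed.

(** The Sylow q-subgroups of N invariant under H are permuted transitively by
    'C_N(H) = 1. There is thus exactly one of them, and H <*> C normalises it
    because it normalises H. *)
Lemma invariant_Sylow q :
  exists2 Q : {group gT}, q.-Sylow(N) Q & B \subset 'N(Q).
Proof.
have [Q sylQ nQH] := sol_coprime_Sylow_exists q solH nNH coNH.
exists Q => //; apply/subsetP=> b Bb.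
have := sol_coprime_Sylow_trans q solH nNH coNH; rewrite regNH => transQ.
have SQ : Q \in [set P in 'Syl_q(N) | H \subset 'N(gval P)]
  by rewrite !inE sylQ.
have SQb : (Q :^ b)%G \in [set P in 'Syl_q(N) | H \subset 'N(gval P)].
  rewrite !inE -{1}(normsP nNB b Bb) pHallJ2 sylQ /= normJ.
  have nHB : B \subset 'N(H) by have [/andP[]] := sdprod_context defB.
  by rewrite -(normsP nHB b Bb) conjSg.
have [x /set1P-> /(congr1 val) /= DQ] := atransP2 transQ SQ SQb.
by rewrite inE DQ conjsg1.
Qed.

(** If C had no fixed points in V, then H would centralise V by
    Frobenius_coprime_act_cent, whereas H acts freely on N. *)
Lemma cent_compl_neq1 V :
  abelian (gval V) -> V \subset N -> B \subset 'N(V) -> V :!=: 1 ->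
    'C_V(C) != 1.
Proof.
move=> abV sVN nVB; apply: contraNneq => regC.
have coHV : coprime #|H| #|V| by rewrite coprime_sym (coprimeSg sVN).
have := Frobenius_coprime_act_cent frobHC abV nVB coHV regC.
by rewrite centsC -subG1 -regNH subsetI sVN.
Qed.

(** The element g that takes v to v ^+ j can be modified by an element of N
    centralising v ^+ j so that it normalises Q. Write it then as a product of
    elements of N, H and C. The factor in N normalises Q, hence centralises
    'Z(Q), and the factor in C fixes v and its powers. So the factor in H takes
    v to v ^+ j, and it is 1 by upper_ker_power_fix. *)
Lemma central_conj_power Q q v j :
    q.-Sylow(N) (gval Q) -> B \subset 'N(Q) -> v \in 'C_('Z(Q))(C) -> v != 1 ->
  v ^+ j \in v ^: G -> v ^+ j = v.
Proof.
move=> sylQ nQB /setIP[Zv cCv] ntv /imsetP[g Gg Dvj].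
have sQN := pHall_sub sylQ.
have Nv : v \in N by rewrite (subsetP (subset_trans (center_sub Q) sQN)).
have Zvj : v ^ g \in 'Z(Q) by rewrite -Dvj groupX.
have nNg : g \in 'N(N) := subsetP (normal_norm nsNG) g Gg.
have [x /setIP[Nx cvx] nQgx] := Sylow_center_fusion sylQ nNg Zv Zvj.
have : g * x \in N * B by rewrite mulNB groupM // (subsetP (normal_sub nsNG)).
case/mulsgP=> n b Nn Bb Dgx.
have nQn : n \in 'N_N(Q).
  by rewrite inE Nn -(groupMr _ (subsetP nQB b Bb)) -Dgx.
have := Frobenius_norm_Sylow_cent frobNH solH sylQ (subset_trans sHB nQB).
move=> /subsetP/(_ n nQn)/centP/(_ v Zv) cvn.
have : b \in H * C by rewrite mulHC.
case/mulsgP=> h c Hh Cc Db.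
have fixj : (v ^+ j) ^ c = v ^+ j.
  by rewrite conjXg; congr (_ ^+ j); apply/conjg_fixP/commgP/(centP cCv).
have Dvh : v ^ h = v ^+ j.
  apply: (conjg_inj c); rewrite -conjgM -Db fixj.
  have fixn : v ^ n = v by apply/conjg_fixP/commgP.
  by rewrite -{1}fixn -conjgM -Dgx conjgM Dvj;
    apply/conjg_fixP/commgP/esym/cent1P.
have := upper_ker_power_fix _ ntv Hh Dvh; rewrite inE Nv => /(_ cCv) h1.
by rewrite -Dvh h1 conjg1.
Qed.

(** Let v be a non-trivial element of 'Z(Q) fixed by C, where Q is an invariant
    Sylow q-subgroup with q odd. Then v is conjugate to v ^+ 4 by
    quadratic_sqr_conj, hence equal to it, and v has order 3. *)
Lemma lower_ker_primes : {subset \pi(N) <= [:: 2; 3]}.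
Proof.
move=> q; rewrite mem_primes => /and3P[q_pr _ q_dv].
have [Q sylQ nQB] := invariant_Sylow q; have [sQN qQ _] := and3P sylQ.
have ntQ : Q :!=: 1 := Sylow_neq1 sylQ q_pr q_dv.
have ntZ : 'Z(Q) != 1 by rewrite center_nil_eq1 // (pgroup_nil qQ).
have /trivgPn[v CZv ntv] : 'C_('Z(Q))(C) != 1.
  apply: cent_compl_neq1 => //; first exact: center_abelian.
    exact: subset_trans (center_sub Q) sQN.
  exact: char_norm_trans (center_char Q) nQB.
have Qv : v \in Q by case/setIP: CZv => /(subsetP (center_sub Q)).
have qv : q.-nat #[v] := mem_p_elt qQ Qv.
have q_dv_v : q %| #[v].
  by have [] := pgroup_pdiv (qv : q.-group <[v]>); rewrite ?cycle_eq1.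
rewrite !inE; have [// | ne_q2] := eqVneq q 2 => /=.
have co2v : coprime 2 #[v].
  by rewrite coprime_sym (pnat_coprime qv) // pnatE // !inE eq_sym.
have Gv := subsetP (subset_trans sQN (normal_sub nsNG)) v Qv.
have := central_conj_power sylQ nQB CZv ntv (quadratic_sqr_conj quadG Gv co2v).
move/eqP; rewrite -{2}[v]expg1 eq_expg_mod_order eqn_mod_dvd // => v_dv3.
by rewrite -(dvdn_prime2 q_pr) // (dvdn_trans q_dv_v).
Qed.

(** By Burnside's theorem on groups of order p^a q^b, N is solvable. *)
Lemma lower_ker_nil : nilpotent N.
Proof.
apply: Frobenius_sol_kernel_nil frobNH solH _; apply: Burnside_p_a_q_b.
exact: (uniq_leq_size (primes_uniq _) lower_ker_primes).
Qed.

(** A non-trivial element of N that is central in 'F(G) shows that 'F(G) meets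
    N <*> H in N only. Hence for b in 'F(G) normalising H, the commutators of b
    with H are in 'F(G) :&: H = 1. Then b is in H, and so b = 1. *)
Lemma Fitting_lower_ker : nilpotent N -> 'F(G) = N.
Proof.
move=> nilN.
have sNF : N \subset 'F(G) := Fitting_max nsNG nilN.
have [_ ntN _ _ _] := Frobenius_context frobNH.
have sNK : N \subset N <*> H := joing_subl N H.
have nsNF : N <| 'F(G) := normalS sNF (Fitting_sub G) nsNG.
have /trivgPn[z /setIP[Nz cFz] ntz] : N :&: 'Z('F(G)) != 1.
  by rewrite meet_center_nil ?Fitting_nil.
have FK x : x \in 'F(G) -> x \in N <*> H -> x \in N.
  move=> Fx Kx; apply: (subsetP (Frobenius_cent1_ker frobNH (x := z) _)).
    by rewrite !inE ntz.
  by have /setIP[_ /centP/(_ x Fx) czx] := cFz; rewrite inE Kx;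
    apply/cent1P/esym.
have FH x : x \in 'F(G) -> x \in H -> x = 1.
  move=> Fx Hx; apply/eqP;
    rewrite -in_set1 -[[set 1]]tiNB inE (subsetP sHB) // andbT.
  by rewrite FK // (subsetP (joing_subr N H)).
apply/eqP; rewrite eqEsubset sNF andbT; apply/subsetP=> x Fx.
have : x \in N * B by rewrite mulNB (subsetP (Fitting_sub G)).
case/mulsgP=> n b Nn Bb Dx; rewrite Dx groupMl //.
have Fb : b \in 'F(G) by rewrite -(groupMl _ (subsetP sNF n Nn)) -Dx.
have [_ /trivgPn[h Hh nth] _ _ _] := Frobenius_context frobHC.
have Hb : b \in H.
  apply: (subsetP (Frobenius_cent1_ker frobHC (x := h) _));
    first by rewrite !inE nth.
  rewrite inE Bb; apply/cent1P/commgP/eqP/FH.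
    rewrite commgEl groupMl ?groupV // memJ_norm //.
    by rewrite (subsetP (normal_norm (Fitting_normal G))) // (subsetP sHG).
  have nHB : b \in 'N(H) by have [/andP[_ /subsetP->]] := sdprod_context defB.
  by rewrite commgEr groupM ?groupV ?memJ_norm ?groupV.
by rewrite (FH b).
Qed.

Lemma quotient_Frobenius M :
    gval M \subset N -> B \subset 'N(M) ->
  [Frobenius B / M = (H / M) ><| (C / M)].
Proof.
move=> sMN nMB.
have injB : 'injm (restrm nMB (coset M)).
  by rewrite ker_restrm ker_coset setIC -tiNB setSI.
have := injm_Frobenius (subxx B) injB frobHC.
by rewrite !morphim_restrm setIid (setIidPr sHB) (setIidPr sCB).
Qed.

Lemma quotient_Frobenius_cyclic n m :
  cyclic C -> #|H| = n -> #|C| = m -> Frobenius_cyclic (G / N) n m.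
Proof.
move=> cycC <- <-; exists (H / N)%G, (C / N)%G.
have tiNH : N :&: H = 1 by apply/trivgP; rewrite -tiNB setIS.
have tiNC : N :&: C = 1 by apply/trivgP; rewrite -tiNB setIS.
rewrite !quotient_cyclic //; split=> //.
- by have := quotient_Frobenius (subxx N) nNB;
    rewrite -(quotientMidl N B) mulNB.
- by apply/esym/card_isog/quotient_isog.
by apply/esym/card_isog/quotient_isog; rewrite // (subset_trans sCB).
Qed.

(** Let V be the largest abelian quotient of N of q-power order. If [~: V, C]
    were all of V, then C would have no fixed points in V, and H would
    centralise V. So N <*> C has an abelian quotient in which the image of N is
    a non-trivial q-group, and thus a linear character that is not trivial on
    N. *)
Lemma lin_char_trivial_on_compl q :
    prime q -> q %| #|N| -> coprime q #|C| ->
  exists (psi : 'CF(N <*> C)) (n : gT) (e : nat),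
    [/\ psi \is a linear_char, {in C, forall c, psi c = 1%R}, n \in N,
        psi n != 1%R & (psi n ^+ e = 1)%R /\ q.-nat e].
Proof.
move=> q_pr q_dv co_qC; have nilN := lower_ker_nil; pose O := 'O_q^'(N)%G.
pose M := (N^`(1) <*> O)%G.
have chM : M \char N by rewrite charY ?der_char ?pcore_char.
have [sMN nMN] := andP (char_normal chM); have nMB := char_norm_trans chM nNB.
have nMH := subset_trans sHB nMB; have nMC := subset_trans sCB nMB.
pose V := (N / M)%G; pose Cb := (C / M)%G.
have abV : abelian V by rewrite sub_der1_abelian ?joing_subl.
have hallO : q^'.-Hall(N) O := nilpotent_pcore_Hall q^' nilN.
have qV : q.-group V.
  rewrite /pgroup card_quotient // (pnat_dvd (indexgS N (joing_subr _ O))) //.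
  by have /and3P[_ _] := hallO; rewrite pnatNK.
have ntV : V :!=: 1.
  have ntNO : N / O != 1.
    rewrite quotient_neq1 ?pcore_normal // properEneq pcore_sub andbT.
    apply: contraTneq q_dv => defO; rewrite -p'natE // -defO;
      exact: pcore_pgroup.
  have := sol_der1_proper (quotient_sol O (nilpotent_sol nilN)) (subxx _) ntNO.
  rewrite -quotient_der ?gFnorm // => /proper_subn; apply: contraNneq => V1.
  have sNM : N \subset M by rewrite -quotient_sub1 ?V1.
  by rewrite -(quotientYidr (subset_trans (der_sub 1 N) (gFnorm _ N)))
    quotientS.
have coVH : coprime #|H / M| #|V|.
  by rewrite coprime_sym coprime_morph.
have coVC : coprime #|V| #|Cb|
  by rewrite (pnat_coprime qV) // p'natE // -prime_coprime // coprime_morphr.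
have regV : 'C_V(H / M) = 1.
  by rewrite -coprime_quotient_cent ?nilpotent_sol // regNH quotient1.
have nVB : B / M \subset 'N(V) by rewrite quotient_norms.
have nVC : Cb \subset 'N(V) by rewrite quotient_norms // (subset_trans sCB).
pose D := [~: V, Cb]%G.
have notVD : ~~ (V \subset D).
  apply: contra ntV => sVD.
  have regC : 'C_V(Cb) = 1.
    by apply/trivgP; rewrite -(coprime_abel_cent_TI nVC coVC abV) setSI.
  have := Frobenius_coprime_act_cent (quotient_Frobenius sMN nMB) abV nVB coVH
    regC.
  by rewrite centsC -subG1 -regV subsetI subxx.
pose T := (N <*> C)%G; have nMT : T \subset 'N(M) by rewrite join_subG nMN.
have nsMT : M <| T by rewrite /normal nMT (subset_trans sMN) ?joing_subl.
have sT'D : (T / M)^`(1) \subset D.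
  have defT : (T / M)%g = V <*> Cb by rewrite quotientY.
  rewrite defT der1_min //.
    by rewrite join_subG commg_norml commg_normr.
  rewrite quotientY ?commg_norml ?commg_normr // abelianY.
  rewrite (quotient_abelian _ abV) !quotient_abelian
    ?(cyclic_abelian compl_cyclic) //=.
  by rewrite quotient_cents2r // commGC.
have [y Vy D'y] := subsetPn notVD.
have [i lin_i y_i] : 
    exists2 i : Iirr (T / M), ('chi_i \is a linear_char)%R &
      y \notin cfker ('chi_i)%R.
  apply/exists_inP; apply: contraR D'y => /exists_inPn no_i.
  apply: (subsetP sT'D); rewrite -cap_cfker_lin_irr; apply/bigcapP=> i lin_i.
  by have := no_i i lin_i; rewrite negbK.
have [n nMn Nn Dy] := morphimP Vy; have Tn : n \in T
  by rewrite (subsetP (joing_subl N C)).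
pose psi1 := (('chi_i)%R %% M)%CF; have lin1 : psi1 \is a linear_char
  by rewrite cfMod_lin_char.
have psi1n : psi1 n = ('chi_i y)%R by rewrite cfModE // Dy.
have Ty : y \in (T / M)%g by rewrite Dy mem_quotient.
(* The power with exponent #|C| is trivial on C. It is not trivial on n,
   because psi1 n has q-power order and q is prime to #|C|. *)
exists (psi1 ^+ #|C|)%R, n, #[y]; split=> //.
- by rewrite rpredX.
- move=> c Cc; rewrite exp_cfunE ?(subsetP (joing_subr N C)) //.
  by rewrite -lin_charX ?(subsetP (joing_subr N C)) // expg_cardG // lin_char1.
- rewrite exp_cfunE // psi1n; apply: contraNneq y_i => w1.
  rewrite cfkerEirr inE (lin_char1 lin_i); apply/eqP.
  have w2 : ('chi_i y ^+ #[y] = 1)%R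
    by rewrite -lin_charX // expg_order lin_char1.
  have co_yC : coprime #[y] #|C|.
    by rewrite (pnat_coprime (mem_p_elt qV Vy)) // p'natE // -prime_coprime.
  have [u v Duv _] := egcdnP #|C| (order_gt0 y); rewrite (eqP co_yC) in Duv.
  have : ('chi_i y ^+ (u * #[y]) = 'chi_i y ^+ (v * #|C| + 1))%R by rewrite Duv.
  by rewrite mulnC exprM w2 exprD mulnC exprM w1 !expr1n expr1 mul1r => <-.
split; last exact: mem_p_elt qV Vy.
by rewrite exp_cfunE // psi1n exprAC -lin_charX // expg_order lin_char1 ?expr1n.
Qed.

(** Suppose that #|C| > 2 and let v be a q-element of N fixed by C as in
    lower_ker_primes, c a generator of C, and x = v * c. The field of the
    column of x is already generated by a root of unity of order #|C|. An
    automorphism that fixes this root and squares the roots of unity of q-power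
    order then fixes the whole column, so that x is conjugate to v ^+ 2 * c.
    Taking suitable powers, v is conjugate to v ^+ 2, in contradiction to
    central_conj_power. *)
Lemma semi_rational_compl_le2 q :
  semi_rational G -> prime q -> q %| #|N| -> coprime q #|C| -> 2 < q ->
    #|C| <= 2.
Proof.
move=> semiG q_pr q_dv co_qC q_gt2; rewrite leqNgt; apply/negP=> m_gt2.
have [c [j [defC lin_j prim_z z_N]]] := compl_lin_char.
have Cc : c \in C by rewrite defC cycle_id.
have oc : #[c] = #|C| by rewrite defC.
have [Q sylQ nQB] := invariant_Sylow q; have [sQN qQ _] := and3P sylQ.
have ntQ : Q :!=: 1 := Sylow_neq1 sylQ q_pr q_dv.
have ntZ : 'Z(Q) != 1 by rewrite center_nil_eq1 // (pgroup_nil qQ).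
have /trivgPn[v CZv ntv] : 'C_('Z(Q))(C) != 1.
  apply: cent_compl_neq1 => //; first exact: center_abelian.
    exact: subset_trans (center_sub Q) sQN.
  exact: char_norm_trans (center_char Q) nQB.
have [Zv /centP cCv] := setIP CZv; have Qv := subsetP (center_sub Q) v Zv.
have qv : q.-nat #[v] := mem_p_elt qQ Qv.
have co_v k : prime k -> k != q -> coprime #[v] k.
  by move=> k_pr ne_kq; rewrite (pnat_coprime qv) // pnatE // !inE.
have co_vC : coprime #[c] #[v].
  by rewrite oc coprime_sym (pnat_coprime qv) // p'natE // -prime_coprime.
have Nv := subsetP sQN v Qv; have cvc := cCv c Cc; pose x := v * c.
have ox : #[x] = (#[v] * #[c])%N by rewrite orderM // coprime_sym.
have Gx : x \in G := groupM (subsetP (normal_sub nsNG) v Nv) (subsetP sCG c Cc).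
(* The k-th power map fixes c and squares v. *)
pose k := chinese #[c] #[v] 1 2.
have k1 : k = 1 %[mod #[c]] by rewrite chinese_modl.
have k2 : k = 2 %[mod #[v]] by rewrite chinese_modr.
have co_kx : coprime k #[x].
  rewrite ox coprimeMr -coprime_modl k2 coprime_modl -[coprime k _]coprime_modl
    k1.
  by rewrite coprime_modl coprime1n andbT coprime_sym co_v // ltn_eqF.
have [nu nuE] := Qn_aut_exists co_kx.
have Dxk : x ^+ k = v ^+ 2 * c.
  rewrite expgMn // -(expg_mod_order v) k2 expg_mod_order.
  by rewrite -(expg_mod_order c) k1 expg_mod_order expg1.
have /imsetP[g Gg Dg] : x ^+ k \in x ^: G.
  apply/eq_irr_mem_classP=> // i; rewrite -(aut_char_expg (irr_char i) Gx nuE).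
  apply: (Qdegree_le2_prim_root_fix m_gt2 prim_z _ (semiG x Gx)).
  - by rewrite -(z_N v Nv); apply: image_f.
  - rewrite -(z_N v Nv) (aut_char_expg (irr_char j) Gx nuE).
    rewrite (lin_charX lin_j _ Gx) z_N // -[RHS]expr1; apply/eqP.
    by rewrite (eq_prim_root_expr prim_z) -oc k1.
  exact: image_f.
(* The e-th power map extracts the factor in <[v]>. *)
pose e := chinese #[c] #[v] 0 1.
have e1 : e = 0 %[mod #[c]] by rewrite chinese_modl.
have e2 : e = 1 %[mod #[v]] by rewrite chinese_modr.
have Dxe w : (v ^+ w * c) ^+ e = v ^+ w.
  rewrite expgMn; last by apply/commute_sym/commuteX/commute_sym.
  rewrite expgAC -(expg_mod_order v) e2 expg_mod_order expg1.
  by rewrite -(expg_mod_order c) e1 mod0n mulg1.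
have Dx1 : x ^+ e = v by rewrite /x -{1}[v]expg1 Dxe // expg1.
have v2 : v ^+ 2 = v.
  apply: (central_conj_power sylQ nQB CZv ntv); apply/imsetP; exists g => //.
  by have := congr1 (natexp^~ e) Dg; rewrite /= -conjXg Dxk Dxe // Dx1.
by case/eqP: ntv; apply: (mulgI v); rewrite mulg1 -expg2 v2.
Qed.

(** The counterpart for rows of semi_rational_compl_le2. Here the row is that
    of the product of a linear character of G / (N <*> H), with values of order
    #|C|, and of the character of G induced from a linear character psi of N
    <*> C that is trivial on C. The latter is irreducible by Clifford theory,
    and it agrees with psi on N * c. If #|C| > 2, then the automorphism that
    fixes roots of order #|C| and squares those of q-power order fixes the row,
    so that the values of psi on N equal their squares. *)
Lemma character_quadratic_compl_le2 q :
  character_quadratic G -> prime q -> q %| #|N| -> coprime q #|C| -> 2 < q ->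
  #|C| <= 2.
Proof.
move=> quad q_pr q_dv co_qC q_gt2; rewrite leqNgt; apply/negP=> m_gt2.
have [c [j [defC lin_j prim_z z_N]]] := compl_lin_char.
have Cc : c \in C by rewrite defC cycle_id.
have [psi [n [e [lin_psi psiC Nn psi_n [psi_e qe]]]]] :=
  lin_char_trivial_on_compl q_pr q_dv co_qC.
pose T := (N <*> C)%G; have sNT : N \subset T := joing_subl N C.
have sCT : C \subset T := joing_subr N C.
have sTG : T \subset G by rewrite join_subG (normal_sub nsNG).
have /irrP[t Dt] : 'Res[N]%R psi \in irr N by apply/lin_char_irr/cfRes_lin_char.
have nt_t : t != 0%R.
  apply: contraNneq psi_n => t0; have := congr1 (fun f : 'CF(N) => f n) Dt.
  by rewrite /= t0 irr0 cfun1E Nn cfResE // => ->.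
have nNT : T \subset 'N(N) by rewrite join_subG normG (subset_trans sCB).
have sTI : T \subset 'I_G[('chi_t)%R].
  rewrite subsetI sTG -Dt; apply: subset_trans (subsetIr T _).
  apply: subset_trans (sub_inertia_Res psi nNT).
  by rewrite subsetI subxx sub_inertia.
(* Only the identity of H fixes a non-principal irreducible character of N. *)
have defI : 'I_G[('chi_t)%R]%G = T.
  apply/group_inj/eqP; rewrite eqEsubset sTI andbT; apply/subsetP=> g Ig.
  have := subsetP (Inertia_sub G ('chi_t)%R) g Ig; rewrite -mulNB -mulHC mulgA.
  case/mulsgP=> nh c' /mulsgP[n' h Nn' Hh ->] Cc' Dg.
  have In' : n' \in 'I_G[('chi_t)%R]%G by rewrite (subsetP sTI) ?(subsetP sNT).
  have Ic' : c' \in 'I_G[('chi_t)%R]%G by rewrite (subsetP sTI) ?(subsetP sCT).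
  have Ih : h \in 'I_(N <*> H)[('chi_t)%R].
    rewrite inE (subsetP (joing_subr N H)) //.
    suffices /setIP[] : h \in 'I_G[('chi_t)%R]%G by [].
    by rewrite -(groupMl _ In') -(groupMr _ Ic') -Dg.
  have Nh : h \in N by rewrite (inertia_Frobenius_ker (FrobeniusWker frobNH)
    nt_t) in Ih.
  rewrite Dg; exact: groupM (subsetP sNT _ (groupM Nn' Nh))
    (subsetP sCT c' Cc').
have irr_ind : 'Ind[G]%R psi \in irr G.
  have /irrP[s Ds] := lin_char_irr lin_psi; rewrite Ds.
  have [irrInd _ _ _ _] := constt_Inertia_bijection t nsNG; move: irrInd;
    rewrite defI; apply.
  by rewrite irr_consttE -Frobenius_reciprocity -Ds Dt cfnorm_irr oner_eq0.
have /irrP[l Dl] : ('chi_j * 'Ind[G] psi)%R \in irr G by rewrite mul_lin_irr.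
have ntc : c != 1.
  by rewrite -order_gt1 orderE -defC (leq_trans _ m_gt2).
have sTB b : b \in B -> b \in T -> b \in C.
  move=> Bb; rewrite /= norm_joinEr ?(subset_trans sCB) //.
  case/mulsgP=> n1 c1 Nn1 Cc1 Db; suffices n1_1 : n1 = 1
    by rewrite Db n1_1 mul1g.
  apply/eqP; rewrite -in_set1 -[[set 1]]tiNB inE Nn1.
  by rewrite -(groupMr _ (subsetP sCB c1 Cc1)) -Db.
(* The coset N * c meets the conjugates of T inside T only. *)
have conjT n' y : n' \in N -> y \in G -> (n' * c) ^ y \in T -> y \in T.
  move=> Nn'; rewrite -mulNB -mulHC mulgA.
  case/mulsgP=> nh c1 /mulsgP[n1 h Nn1 Hh ->] Cc1 ->.
  have [Tc1 Bh] := (subsetP sCT c1 Cc1, subsetP sHB h Hh).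
  have nNh := subsetP nNB h Bh; have Bc := subsetP sCB c Cc.
  have nNc := subsetP nNB c Bc.
  rewrite !conjgM memJ_norm ?(subsetP (normG T)) //.
  pose n2 := (n' * c) ^ n1 * c^-1; have Nn2 : n2 \in N.
    have -> : n2 = n1^-1 * n' * n1 ^ c^-1 by rewrite /n2 !conjgE invgK !mulgA.
    have Nn1c : n1 ^ c^-1 \in N by rewrite memJ_norm ?groupV.
    exact: groupM (groupM (groupVr Nn1) Nn') Nn1c.
  have -> : (n' * c) ^ n1 = n2 * c by rewrite /n2 mulgKV.
  rewrite conjMg groupMl => [Tch|]; last by rewrite (subsetP sNT) ?memJ_norm.
  have Cch : c ^ h \in C by apply: sTB => //; rewrite groupJ.
  suffices h1 : h = 1 by rewrite h1 mulg1 groupM // (subsetP sNT).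
  have hc : [~ c, h] = 1.
    apply/eqP; rewrite -in_set1 -[[set 1]]tiHC; apply/setIP; split.
      have Hhc : h^-1 ^ c \in H by rewrite memJ_norm ?groupV ?(subsetP nHC).
      by rewrite commgEr; apply: groupM Hhc Hh.
    by rewrite commgEl; apply: groupM (groupVr Cc) Cch.
  apply/eqP; rewrite -in_set1 -[[set 1]](Frobenius_reg_ker frobHC (x := c)).
    by rewrite inE Hh; apply/cent1P/commute_sym/commgP/eqP.
  by rewrite !inE ntc.
have ind_val n' : n' \in N -> ('Ind[G] psi (n' * c)%g = psi n')%R.
  move=> Nn'; rewrite cfIndE //; apply: canLR (mulKf (neq0CG T)) _.
  rewrite (bigID [in T]) /= addrC big1 ?add0r => [|y /andP[Gy T'y]]; last first.
    by rewrite cfun0 //; apply: contra T'y; apply: conjT.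
  rewrite (eq_bigr (fun=> psi n')) => [|y /andP[_ Ty]].
    rewrite sumr_const [RHS]mulr_natl; congr (_ *+ _)%R; apply: eq_card => y.
    by rewrite [LHS]unfold_in /= andb_idl //; apply: (subsetP sTG).
  have [Tn1 Tc] := (subsetP sNT n' Nn', subsetP sCT c Cc).
  by rewrite cfunJ // lin_charM // (psiC c Cc) mulr1.
pose s := [seq ('chi_l x)%R | x in G].
have val n' : n' \in N -> ('chi_l (n' * c)%g = 'chi_j c * psi n')%R.
  by move=> Nn'; rewrite -Dl cfunE ind_val // z_N.
have s_val n' : n' \in N -> ('chi_j c * psi n')%R \in s.
  move=> Nn'; rewrite -val //; apply: image_f.
  exact: groupM (subsetP (normal_sub nsNG) n' Nn') (subsetP sCG c Cc).
pose z := ('chi_j c)%R; pose w := psi n.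
have sz : z \in s by rewrite /z -[X in X \in s]mulr1 -(psiC 1) // s_val.
have co_e k : prime k -> k != q -> coprime e k.
  by move=> k_pr ne_kq; rewrite (pnat_coprime qe) // pnatE // !inE.
have co_Ce : coprime #|C| e.
  by rewrite coprime_sym (pnat_coprime qe) // p'natE // -prime_coprime.
(* The automorphism nu defined by k fixes z and squares w. *)
pose k := chinese #|C| e 1 2.
have k1 : k = 1 %[mod #|C|] by rewrite chinese_modl.
have k2 : k = 2 %[mod e] by rewrite chinese_modr.
have co_k : coprime k (#|C| * e).
  rewrite coprimeMr -coprime_modl k1 coprime_modl coprime1n -coprime_modl k2
    coprime_modl.
  by rewrite coprime_sym co_e // ltn_eqF.
have [nu nuE] := Qn_aut_exists co_k.
have zm : (z ^+ #|C| = 1)%R := prim_expr_order prim_z.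
have nu_z : nu z = z.
  rewrite nuE ?exprM ?zm ?expr1n // -[RHS]expr1; apply/eqP.
  by rewrite (eq_prim_root_expr prim_z) k1.
have fix_s := Qdegree_le2_prim_root_fix m_gt2 prim_z sz (quad l) nu_z.
have nz_z : z != 0%R by rewrite lin_char_neq0 // (subsetP sCG).
have fix_w : nu w = w.
  by apply: (mulfI nz_z); rewrite -{1}(fix_s z sz) -rmorphM /= fix_s // s_val.
have nz_w : w != 0%R by rewrite lin_char_neq0 // (subsetP sNT).
case/eqP: psi_n; apply: (mulfI nz_w); rewrite mulr1 -expr2 -[RHS]fix_w nuE.
  by rewrite -(expr_mod 2 psi_e) -k2 expr_mod.
by rewrite mulnC exprM psi_e expr1n.
Qed.

End TwoFrobenius.

(** The prime p = #|H| and m = #|C| satisfy m | p - 1 <= 2 m with m in {2, 3,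
    4, 6}, which leaves six pairs. The prime 3 is excluded from N for (3, 2)
    because N and H have coprime orders, and for (5, 4) by
    semi_rational_compl_le2 and character_quadratic_compl_le2, as 3 is prime to
    4. *)
Lemma quadratic_two_Frobenius (gT : finGroupType) (G : {group gT}) :
    two_Frobenius G -> character_quadratic G \/ semi_rational G ->
  (2.-group 'F(G) /\
    (Frobenius_cyclic (G / 'F(G)) 3 2 \/ Frobenius_cyclic (G / 'F(G)) 5 4))
  \/
  ({subset \pi('F(G)) <= [:: 2; 3]} /\
    [\/ Frobenius_cyclic (G / 'F(G)) 5 2, Frobenius_cyclic (G / 'F(G)) 7 3,
        Frobenius_cyclic (G / 'F(G)) 7 6
      | Frobenius_cyclic (G / 'F(G)) 13 6]).
Proof.
move=> frobG quadG.
have [N [H [C [defG frobNH frobHC cycH oddH]]]] :=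
  two_Frobenius_structure frobG.
have nilN := lower_ker_nil defG frobNH frobHC cycH quadG.
have defF := Fitting_lower_ker defG frobNH frobHC nilN.
have cycC := compl_cyclic defG frobHC cycH oddH quadG.
have FC n m :=
  quotient_Frobenius_cyclic (n := n) (m := m) defG frobHC cycH cycC.
have p_pr := upper_ker_prime defG frobHC cycH oddH quadG.
have m_le := upper_ker_card_le defG frobHC cycH oddH quadG.
have m_dv := upper_ker_card_dvd frobHC.
have piN := lower_ker_primes defG frobNH frobHC cycH quadG.
have cardC := compl_card defG frobNH frobHC cycH oddH quadG.
have not3 : coprime 3 #|C| -> 2 < #|C| -> ~~ (3 %| #|N|).
  move=> co3C C_gt2; apply/negP=> dv3; move: C_gt2; rewrite ltnNge => /negP[].
  case: quadG => quad.
    exact: (character_quadratic_compl_le2 defG frobNH frobHC cycH oddH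
      (or_introl quad) quad (isT : prime 3)).
  exact: (semi_rational_compl_le2 defG frobNH frobHC cycH oddH (or_intror quad)
    quad (isT : prime 3)).
have group2 : ~~ (3 %| #|N|) -> 2.-group N.
  move=> n3; apply/pgroupP=> q q_pr q_dv; have := piN q.
  rewrite mem_primes q_pr cardG_gt0 q_dv !inE => /(_ isT)/orP[] // /eqP q3.
  by rewrite q3 (negPf n3) in q_dv.
rewrite defF in FC *; have coNH := Frobenius_coprime frobNH.
have : (#|H|, #|C|) \in [:: (3, 2); (5, 4); (5, 2); (7, 3); (7, 6); (13, 6)].
  have [d Dp] := dvdnP m_dv; have p_gt1 := prime_gt1 p_pr.
  have Dp1 : #|H| = (d * #|C|).+1 by rewrite -Dp prednK ?prime_gt0.
  move: m_le p_pr oddH p_gt1;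
    rewrite {}Dp {}Dp1 -mul2n leq_pmul2r ?cardG_gt0 //.
  move: cardC; rewrite !inE => /or4P[]/eqP->; by case: d => [|[|[|]]].
rewrite !inE => /or4P[/eqP[p3 m2]|/eqP[p5 m4]|/eqP[p5 m2]|].
- left; split; last by left; apply: FC.
  by apply: group2; rewrite -prime_coprime // coprime_sym -p3.
- left; split; last by right; apply: FC.
  by apply: group2; apply: not3; rewrite m4.
- by right; split=> //; constructor 1; apply: FC.
case/or3P=> /eqP[pE mE]; right; split=> //.
- by constructor 2; apply: FC.
- by constructor 3; apply: FC.
by constructor 4; apply: FC.
Qed.

(** * Character tables over an elementary abelian lower kernel *)

(** The assumptions on C say that the powers of a group element x with exponent
    prime to #|G| are conjugate to x or to its inverse when x is outside
    V <*> H, and that they form at most two conjugacy classes when x is in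
    V <*> H but not in V. Powers with such an exponent, which is odd, do not
    change the elements of V. *)
Section SplitTwoFrobenius.

Variables (gT : finGroupType) (G V H C : {group gT}).
Hypothesis defG : V ><| (H <*> C) = G.
Hypothesis frobVH : [Frobenius V <*> H = V ><| H].
Hypothesis frobHC : [Frobenius H <*> C = H ><| C].
Hypotheses (pr_H : prime #|H|) (abelV : 2.-abelem V).
Hypothesis unitC : forall k, coprime k #|C| ->
  (k == 1 %[mod #|C|]) || (k == #|C|.-1 %[mod #|C|]).
Hypothesis leHC : #|H|.-1 <= #|C|.*2.

Let B := (H <*> C)%G.
Let K := (V <*> H)%G.
Let nsVG : V <| G. Proof. by have [] := sdprod_context defG. Qed.
Let sBG : B \subset G. Proof. by have [] := sdprod_context defG. Qed.
Let mulVB : V * B = G. Proof. by have [] := sdprod_context defG. Qed.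
Let nVB : B \subset 'N(V). Proof. by have [] := sdprod_context defG. Qed.
Let tiVB : V :&: B = 1. Proof. by have [] := sdprod_context defG. Qed.
Let defB : H ><| C = B. Proof. by have [] := Frobenius_context frobHC. Qed.
Let sHB : H \subset B. Proof. by have /sdprod_context[/andP[]] := defB. Qed.
Let sCB : C \subset B. Proof. by have /sdprod_context[] := defB. Qed.
Let mulHC : H * C = B. Proof. by have /sdprod_context[] := defB. Qed.
Let nHB : B \subset 'N(H). Proof. by have /sdprod_context[/andP[]] := defB. Qed.
Let sHG : H \subset G := subset_trans sHB sBG.
Let sCG : C \subset G := subset_trans sCB sBG.
Let sVG : V \subset G := normal_sub nsVG.
Let abV : abelian V := abelem_abelian abelV.
Let sVK : V \subset K := joing_subl V H.
Let mulVH : V * H = K.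
Proof. by rewrite /= norm_joinEr // (subset_trans sHB). Qed.
Let nsKG : K <| G.
Proof.
rewrite /normal join_subG sVG sHG -mulVB mulG_subG.
rewrite (subset_trans sVK (normG K)) /=.
by rewrite normsY.
Qed.
Let cardG_even : 2 %| #|G|.
Proof.
have [_ ntV _ _ _] := Frobenius_context frobVH.
have [_ ? _] := pgroup_pdiv (abelem_pgroup abelV) ntV.
by apply: dvdn_trans (cardSg sVG).
Qed.
Let cardG_C : #|C| %| #|G|. Proof. exact: cardSg sCG. Qed.
Let cardG_H : #|H| %| #|G|. Proof. exact: cardSg sHG. Qed.

Let V_sqr x : x \in V -> x ^+ 2 = 1.
Proof. by have /(abelemP (isT : prime 2))[_] := abelV; apply. Qed.

Lemma lower_ker_expg x k : x \in V -> coprime k #|G| -> x ^+ k = x.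
Proof.
move=> Vx co_k; have k_odd : odd k
  by rewrite -coprimen2 (coprime_dvdr cardG_even).
by rewrite -(odd_double_half k) k_odd expgS -mul2n expgM V_sqr // expg1n mulg1.
Qed.

(** Squares of elements of V are trivial, so that in y ^+ n.*2 the factors in V
    combine to an element of the form b * b ^ y^-1, a commutator with y. This
    is what makes y ^+ n.*2.+1 conjugate to y when c ^+ n.*2 = 1. *)
Lemma lower_ker_compl_even_power y v c n : v \in V -> c \in C -> y = v * c ->
  exists2 b, b \in V & y ^+ n.*2 = b * b ^ y^-1 * c ^+ n.*2.
Proof.
move=> Vv Cc Dy; have nVc : c \in 'N(V) by rewrite (subsetP nVB) ?(subsetP sCB).
suffices [b Vb Dyn] : exists2 b, b \in V & y ^+ n.*2 = b * b ^ c^-1 * c ^+ n.*2.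
  exists b => //; rewrite Dyn Dy invMg conjgM; congr (_ * _ * _);
    apply/esym/conjg_fixP/commgP.
  by apply: (centsP abV); rewrite ?groupV ?memJ_norm ?groupV.
elim: n => [|n [b Vb IHn]]; first by exists 1;
  rewrite ?group1 // !conj1g !mulg1.
have VJ x a : x \in V -> a \in C -> x ^ a \in V.
  by move=> Vx Ca; rewrite memJ_norm // (subsetP nVB) ?(subsetP sCB).
have cV x1 x2 : x1 \in V -> x2 \in V -> x1 * x2 = x2 * x1 by move=> *;
  apply: (centsP abV).
have Vb' : (b ^ c^-1) ^ c^-1 \in V by rewrite !VJ ?groupV.
exists (v * (b ^ c^-1) ^ c^-1); first exact: groupM.
have swap (x1 x2 x3 x4 : gT) : x2 * x3 = x3 * x2 ->
  x1 * x2 * (x3 * x4) = x1 * x3 * (x2 * x4).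
  by move=> E; rewrite -!mulgA (mulgA x2) E !mulgA.
rewrite doubleS !expgS IHn Dy; set Z := c ^+ _; set b2 := (b ^ _) ^ _.
have -> : v * b2 * (v * b2) ^ c^-1 = v * v ^ c^-1 * (b2 * b2 ^ c^-1).
  by rewrite conjMg; apply/swap/cV; rewrite ?VJ ?groupV.
by rewrite /b2 !conjgE !invgK !mulgA !mulgKV.
Qed.

(** Up to conjugacy y = v * c with v in V and c in C, since outside H every
    element of H <*> C is conjugate to an element of C. Now
    lower_ker_compl_even_power applies. *)
Lemma off_ker_expg_conj y l : y \in G -> y \notin K -> odd l ->
  l = 1 %[mod #|C|] ->
  y ^+ l \in y ^: G.
Proof.
move=> Gy K'y l_odd l1.
have [g Gg [v [c [Vv Cc Dyg]]]] : exists2 g, g \in G & exists v c,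
  [/\ v \in V, c \in C & y ^ g = v * c].
  have : y \in V * B by rewrite mulVB.
  case/mulsgP=> v b Vv Bb Dy.
  have H'b : b \notin H.
    apply: contra K'y => Hb; rewrite Dy groupM ?(subsetP sVK v Vv) //.
    exact: (subsetP (joing_subr V H)).
  have /and3P[/eqP defP _ _] := Frobenius_partition frobHC.
  move: Bb; rewrite -defP => /bigcupP[A];
    rewrite !inE => /orP[/eqP-> | /imsetP[x Hx ->] Ab].
    by rewrite (negPf H'b).
  move: Ab; rewrite conjD1g inE mem_conjg => /andP[_ Cb].
  have Gx : x^-1 \in G by rewrite groupV (subsetP sHG).
  exists x^-1 => //; exists (v ^ x^-1), (b ^ x^-1); split=> //;
    last by rewrite Dy conjMg.
  by rewrite memJ_norm // (subsetP (normal_norm nsVG)).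
set y1 := y ^ g in Dyg.
have Dl : l = l./2.*2.+1 by rewrite -{1}(odd_double_half l) l_odd.
have [b Vb Dy2] := lower_ker_compl_even_power l./2 Vv Cc Dyg.
have c1 : c ^+ l./2.*2 = 1.
  apply/eqP; rewrite -order_dvdn (dvdn_trans (order_dvdG Cc)) //.
  by move: l1; rewrite {1}Dl => /eqP; rewrite eqn_mod_dvd // subn1.
have Gy1 : y1 \in G by rewrite groupJ.
have nVy1 : y1 \in 'N(V) := subsetP (normal_norm nsVG) _ Gy1.
pose u := b ^ y1^-1; have Vu : u \in V by rewrite memJ_norm ?groupV.
have Dy1 : y1 ^+ l = y1 ^ u.
  have uV : u^-1 = u.
    by apply/eqP; rewrite eq_invg_mul -expg2 V_sqr.
  have alg (a1 b1 : gT) : (b1 ^ a1^-1)^-1 = b1 ^ a1^-1 ->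
    a1 * (b1 * b1 ^ a1^-1) = a1 ^ (b1 ^ a1^-1).
    by move=> E; rewrite [RHS]conjgE E !conjgE !invgK !mulgA !mulgKV.
  by rewrite {1}Dl expgS Dy2 c1 mulg1; apply: alg.
have -> : y ^+ l = (y1 ^+ l) ^ g^-1 by rewrite /y1 -conjXg conjgK.
by rewrite Dy1 /y1 -!conjgM imset_f // !groupM ?groupV // (subsetP sVG).
Qed.

Lemma coprime_cardG_odd k : coprime k #|G| -> odd k.
Proof. by move=> co_k; rewrite -coprimen2 (coprime_dvdr cardG_even). Qed.

Lemma off_ker_expg_conj_mod y k1 k2 : y \in G -> y \notin K ->
  coprime k1 #|G| -> coprime k2 #|G| ->
  k1 = k2 %[mod #|C|] -> y ^+ k1 \in (y ^+ k2) ^: G.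
Proof.
move=> Gy K'y co1 co2 eq12.
have k2_gt0 : 0 < k2 by apply: odd_gt0 (coprime_cardG_odd co2).
(* On G, the u-th power map is the inverse of the k2-th power map. *)
have [u v Duv _] := egcdnP #|G| k2_gt0; rewrite (eqP co2) in Duv.
have yu : y ^+ (k2 * u) = y.
  by rewrite mulnC Duv expgD mulnC expgM expg_cardG // expg1n mul1g.
have -> : y ^+ k1 = (y ^+ k2) ^+ (u * k1) by rewrite -expgM mulnA expgM yu.
apply: off_ker_expg_conj; first exact: groupX.
- by apply: contra K'y => Kyk; rewrite -yu expgM groupX.
- have : odd (u * k2)
    by rewrite Duv addn1 /= oddM negb_and -!dvdn2 cardG_even orbT.
  by rewrite !oddM (coprime_cardG_odd co1) (coprime_cardG_odd co2).
by rewrite -modnMmr eq12 modnMmr Duv -modnDml -modnMmr (eqP cardG_C) muln0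
  mod0n.
Qed.

(** Every element of K outside V is conjugate to a power of h. *)
Lemma in_ker_expg_conj x k1 k2 h : H :=: <[h]> -> h ^+ k1 \in (h ^+ k2) ^: C ->
  x \in K -> x \notin V -> x ^+ k1 \in (x ^+ k2) ^: G.
Proof.
move=> defH /imsetP[c Cc Dh] Kx V'x.
have /and3P[/eqP defP _ _] := Frobenius_partition frobVH.
move: Kx; rewrite -defP => /bigcupP[A];
  rewrite !inE => /orP[/eqP-> | /imsetP[g Vg ->] Ax].
  by rewrite (negPf V'x).
move: Ax; rewrite conjD1g inE mem_conjg defH => /andP[_ /cycleP[i Dx]].
have Gg := subsetP sVG g Vg; have Gc := subsetP sCG c Cc.
have {Dx} -> : x = (h ^+ i) ^ g by rewrite -Dx conjgKV.
rewrite -!conjXg -!expgM mulnC expgM Dh -conjXg -expgM mulnC.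
rewrite (_ : (_ ^ c) ^ g = ((h ^+ (i * k2)) ^ g) ^ (g^-1 * c * g)).
  by rewrite imset_f // !groupM ?groupV.
by rewrite -!conjgM !mulgA mulgV mul1g.
Qed.

(** C acts freely on the elements of H other than 1, so that its orbits there
    have length #|C|. There are not enough elements for three orbits. *)
Lemma upper_ker_two_classes h k1 k2 : H :=: <[h]> -> coprime k1 #|G| ->
  coprime k2 #|G| ->
  [\/ h ^+ k1 \in h ^: C, h ^+ k2 \in h ^: C | h ^+ k1 \in (h ^+ k2) ^: C].
Proof.
move=> defH co1 co2; have Hh : h \in H by rewrite defH cycle_id.
have oh : #[h] = #|H| by rewrite defH.
have nth k : coprime k #|G| -> h ^+ k != 1.
  move=> co_k; rewrite -order_dvdn oh -prime_coprime // coprime_sym.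
  exact: coprime_dvdr cardG_H co_k.
have nth1 : h != 1 by rewrite -[h]expg1 nth // coprime1n.
have card_orb x : x \in H -> x != 1 -> #|x ^: C| = #|C|.
  move=> Hx ntx; rewrite -index_cent1 (_ : 'C_C[x] = 1) ?indexg1 //.
  by rewrite (Frobenius_reg_compl frobHC) // !inE ntx.
have [|h1] := boolP (h ^+ k1 \in h ^: C); first by constructor 1.
have [|h2] := boolP (h ^+ k2 \in h ^: C); first by constructor 2.
have [|h12] := boolP (h ^+ k1 \in (h ^+ k2) ^: C); first by constructor 3.
have sub x : x \in H -> x != 1 -> x ^: C \subset H^#.
  move=> Hx ntx; apply/subsetP=> _ /imsetP[c Cc ->].
  by rewrite !inE conjg_eq1 ntx memJ_norm // (subsetP nHB) // (subsetP sCB).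
pose U := h ^: C :|: (h ^+ k1) ^: C :|: (h ^+ k2) ^: C.
have : #|U| <= #|H|.-1.
  rewrite [#|H|](cardsD1 1) group1 /=; apply: subset_leq_card.
  by rewrite !subUset !sub ?groupX ?nth.
have dis x y : x \notin y ^: C -> x ^: C :&: y ^: C = set0.
  move=> xy; apply/setP=> z; rewrite !inE; apply/negP=> /andP[zx zy].
  by case/negP: xy; rewrite -(class_eqP zy) class_sym.
rewrite /U !cardsU !card_orb ?groupX ?nth // setIUl.
rewrite [h ^: C :&: _]setIC (dis _ _ h1) [h ^: C :&: _]setIC (dis _ _ h2)
  (dis _ _ h12).
rewrite setU0 cards0 !subn0 => le3; have := leq_trans le3 leHC.
by rewrite -addnn -[X in _ <= X]addn0 leq_add2l leqNgt cardG_gt0.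
Qed.

Lemma aut_irr_expg (nu : {rmorphism algC -> algC}) : exists2 k, coprime k #|G| &
  forall (i : Iirr G) x, x \in G -> (nu ('chi_i x) = 'chi_i (x ^+ k)%g)%R.
Proof.
have [k co_k nuE] := aut_expg_exists nu (cardG_gt0 G); exists k => // i x Gx.
apply: aut_char_expg; rewrite ?irr_char // => z z1; apply: nuE.
by have /dvdnP[d ->] := order_dvdG Gx; rewrite mulnC exprM z1 expr1n.
Qed.

(** Together with in_ker_Qdegree_le2, this covers the rows and the columns of
    the character table: each of these has entries that vary with powers of the
    group elements on one side of K only. Outside K the powers of x fall into
    at most two classes because the units modulo #|C| are 1 and -1. *)
Lemma off_ker_Qdegree_le2 s :
    {in s, forall a, exists (i : Iirr G) x, [/\ x \in G, a = ('chi_i x)%R &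
       x \notin K \/ forall k, coprime k #|G| ->
         ('chi_i (x ^+ k)%g = 'chi_i x)%R]} ->
  Qdegree s <= 2.
Proof.
move=> sP; apply: (char_values_Qdegree_le2 (G := G)) =>
  [a /sP[i [x [Gx Da _]]] | nu1 nu2].
  by exists i, x.
have [k1 co1 nu1E] := aut_irr_expg nu1; have [k2 co2 nu2E] := aut_irr_expg nu2.
have eq_chi i x l1 l2 : x \in G -> coprime l1 #|G| -> coprime l2 #|G| ->
    l1 = l2 %[mod #|C|] ->
    (x \notin K \/ forall k, coprime k #|G| ->
      ('chi[G]_i (x ^+ k)%g = 'chi_i x)%R) ->
    (('chi_i (x ^+ l1)%g) = 'chi_i (x ^+ l2)%g)%R.
  move=> Gx col1 col2 l12 [K'x|fixx]; last by rewrite !fixx.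
  by have /imsetP[g Gg ->] := off_ker_expg_conj_mod Gx K'x col1 col2 l12;
    rewrite cfunJ.
have co_1 := coprime1n #|G|.
have [/eqP k1_1 | /eqP k1_m] := orP (unitC (coprime_dvdr cardG_C co1)).
  by constructor 1 => _ /sP[i [x [Gx -> fx]]];
    rewrite nu1E // (eq_chi i x k1 1%N).
have [/eqP k2_1 | /eqP k2_m] := orP (unitC (coprime_dvdr cardG_C co2)).
  by constructor 2 => _ /sP[i [x [Gx -> fx]]];
    rewrite nu2E // (eq_chi i x k2 1%N).
by constructor 3 => _ /sP[i [x [Gx -> fx]]];
  rewrite nu1E // nu2E // (eq_chi i x k1 k2) ?k1_m.
Qed.

Lemma in_ker_Qdegree_le2 s :
    {in s, forall a, exists (i : Iirr G) x, [/\ x \in G, a = ('chi_i x)%R &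
       (x \in K) && (x \notin V) \/ forall k, coprime k #|G| ->
         ('chi_i (x ^+ k)%g = 'chi_i x)%R]} ->
  Qdegree s <= 2.
Proof.
move=> sP; apply: (char_values_Qdegree_le2 (G := G)) =>
  [a /sP[i [x [Gx Da _]]] | nu1 nu2].
  by exists i, x.
have [k1 co1 nu1E] := aut_irr_expg nu1; have [k2 co2 nu2E] := aut_irr_expg nu2.
have [h defH] := cyclicP (prime_cyclic pr_H).
have eq_chi i x l1 l2 : x \in G -> coprime l1 #|G| -> coprime l2 #|G| ->
    h ^+ l1 \in (h ^+ l2) ^: C ->
    ((x \in K) && (x \notin V) \/ forall k, coprime k #|G| ->
      ('chi[G]_i (x ^+ k)%g = 'chi_i x)%R) ->
    (('chi_i (x ^+ l1)%g) = 'chi_i (x ^+ l2)%g)%R.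
  move=> Gx col1 col2 l12 [/andP[Kx V'x]|fixx]; last by rewrite !fixx.
  by have /imsetP[g Gg ->] := in_ker_expg_conj defH l12 Kx V'x; rewrite cfunJ.
have co_1 := coprime1n #|G|.
have [h1|h2|h12] := upper_ker_two_classes defH co1 co2.
- by constructor 1 => _ /sP[i [x [Gx -> fx]]];
    rewrite nu1E // (eq_chi i x k1 1%N).
- by constructor 2 => _ /sP[i [x [Gx -> fx]]];
    rewrite nu2E // (eq_chi i x k2 1%N).
by constructor 3 => _ /sP[i [x [Gx -> fx]]];
  rewrite nu1E // nu2E // (eq_chi i x k1 k2).
Qed.

Lemma quotient_Frobenius_ker : [Frobenius G / V with kernel K / V].
Proof.
have frobBV := quotient_Frobenius defG frobHC (subxx V) nVB.
apply/existsP; exists (C / V)%G; move: frobBV.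
by rewrite -(quotientMidl V B) mulVB -(quotientMidl V H) mulVH.
Qed.

(** By Clifford's theorem the restriction to K consists of characters that do
    not have V in their kernel. In the Frobenius group K these are induced from
    V. *)
Lemma irr_vanish_ker i x :
  ~~ (V \subset cfker ('chi[G]_i)%R) -> x \in K -> x \notin V ->
    ('chi_i x = 0)%R.
Proof.
move=> notVi Kx V'x; have sKG := normal_sub nsKG.
rewrite -(cfResE _ sKG Kx) [('Res _)%R]cfun_sum_constt sum_cfunE big1 // =>
  j Cj.
have [|l _ Dj] := Frobenius_Ind_irrP (FrobeniusWker frobVH) j _.
  apply: contra notVi => sVj;
    apply: subset_trans (cfker_constt (cfInd_char _ (irr_char j)) _).
    by rewrite cfker_Ind_irr // sub_gcore // normal_norm.
  by rewrite constt_Ind_Res.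
have nsVK : V <| K := normalS sVK sKG nsVG.
by rewrite cfunE Dj (cfun_on0 (cfInd_normal _ nsVK)) // mulr0.
Qed.

(** As a character of the Frobenius group G / V, it is induced from K / V. *)
Lemma irr_vanish_off_ker i x :
    V \subset cfker ('chi[G]_i)%R -> ~~ (K \subset cfker ('chi_i)%R) ->
  x \in G -> x \notin K -> ('chi_i x = 0)%R.
Proof.
move=> sVi notKi Gx K'x; have sKG := normal_sub nsKG.
have [] := Frobenius_Ind_irrP quotient_Frobenius_ker (quo_Iirr V i) _.
  rewrite quo_IirrE // cfker_quo // quotientSGK //.
  by rewrite (subset_trans sKG) ?normal_norm.
move=> l _; rewrite quo_IirrE // => Di.
rewrite -(cfQuoE nsVG sVi Gx) Di
  (cfun_on0 (cfInd_normal _ (quotient_normal _ nsKG))) //.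
apply: contra K'x => /morphimP[y nVy Ky Dxy].
have /rcosetP[v Vv ->] : x \in V :* y.
  by apply/rcoset_kercosetP; rewrite // (subsetP (normal_norm nsVG)).
by rewrite groupM // (subsetP sVK).
Qed.

Lemma split_semi_rational : semi_rational G.
Proof.
move=> x Gx; have [/andP[Kx V'x]|notKV] := boolP ((x \in K) && (x \notin V)).
  by apply: in_ker_Qdegree_le2 => _ /mapP[i _ ->]; exists i, x; split=> //;
    left; rewrite Kx.
apply: off_ker_Qdegree_le2 => _ /mapP[i _ ->]; exists i, x; split=> //.
have [Kx|] := boolP (x \in K); last by left.
right=> k co_k; rewrite Kx negbK in notKV.
by rewrite lower_ker_expg.
Qed.

Lemma notin_group_expg (A : {group gT}) x k : coprime k #|G| -> x \in G ->
  x \notin A -> x ^+ k \notin A.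
Proof.
rewrite coprime_sym => co_k Gx; apply: contra => Axk.
by rewrite -(expgK co_k Gx) groupX.
Qed.

Lemma split_character_quadratic : character_quadratic G.
Proof.
move=> i; have [sVi | notVi] := boolP (V \subset cfker ('chi_i)%R); last first.
  apply: off_ker_Qdegree_le2 => _ /imageP[x Gx ->]; exists i, x; split=> //.
  have [Kx|] := boolP (x \in K); last by left.
  right=> k co_k; have [Vx | V'x] := boolP (x \in V);
    first by rewrite lower_ker_expg.
  by rewrite !(irr_vanish_ker notVi) ?(groupX k Kx) // (notin_group_expg co_k).
have [sKi | notKi] := boolP (K \subset cfker ('chi_i)%R).
  apply: off_ker_Qdegree_le2 => _ /imageP[x Gx ->]; exists i, x; split=> //.
  have [Kx|] := boolP (x \in K); last by left.
  by right=> k _; rewrite !cfker1 ?(subsetP sKi) ?groupX.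
apply: in_ker_Qdegree_le2 => _ /imageP[x Gx ->]; exists i, x; split=> //.
have [Vx | V'x] := boolP (x \in V); first by right=> k co_k;
  rewrite lower_ker_expg.
have [Kx | K'x] := boolP (x \in K); first by left.
right=> k co_k; have Gxk := groupX k Gx.
by rewrite !(irr_vanish_off_ker sVi notKi) // (notin_group_expg co_k).
Qed.

Lemma split_two_Frobenius : two_Frobenius G.
Proof.
exists V, K; split=> //; first exact: FrobeniusWker frobVH.
exact: quotient_Frobenius_ker.
Qed.

End SplitTwoFrobenius.

(** * Affine groups acting on functions with two values *)

(** The affine maps i |-> a * i + b of 'F_p, with a a power of u, act on the
    group of functions from 'F_p to bool, and all of this takes place inside
    the permutations of 'F_p * bool. The constant functions are fixed by the
    translations; passing to the commutator with the translations discards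
    them and leaves the functions with sum 0, of which only 0 is invariant under
    a translation other than the identity. *)
Section AffineExample.

Variables (p : nat) (u : 'F_p) (m : nat).
Hypotheses (p_pr : prime p) (p_odd : odd p) (m_gt1 : 1 < m).
Hypothesis prim_u : (m.-primitive_root u)%R.

Let T := ('F_p * bool)%type.

Let u_unit : (u \is a GRing.unit)%R.
Proof.
rewrite -(unitrX_pos _ (prim_order_gt0 prim_u)) (prim_expr_order prim_u).
exact: unitr1.
Qed.

Fact shift_inj : injective (fun x : T => ((x.1 + 1)%R, x.2)).
Proof.
move=> [i a] [j b] E; have E1 : (i + 1 = j + 1)%R := congr1 fst E.
by have E2 : a = b := congr1 snd E; rewrite (addIr _ E1) E2.
Qed.
Fact scale_inj : injective (fun x : T => ((u * x.1)%R, x.2)).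
Proof.
move=> [i a] [j b] E; have E1 : (u * i = u * j)%R := congr1 fst E.
by have E2 : a = b := congr1 snd E; rewrite (mulrI u_unit E1) E2.
Qed.
Fact flip_inj (f : {ffun 'F_p -> bool}) : injective (fun x : T =>
  (x.1, x.2 (+) f x.1)).
Proof.
move=> [i a] [j b] E; have E1 : i = j := congr1 fst E.
have E2 : a (+) f i = b (+) f j := congr1 snd E.
by rewrite E1 in E2 *; rewrite (addIb E2).
Qed.

Definition shift : {perm T} := perm shift_inj.
Definition scale : {perm T} := perm scale_inj.
Definition flip f : {perm T} := perm (@flip_inj f).
Definition flips := [set flip f | f : {ffun 'F_p -> bool}].

Lemma flipM f g : flip f * flip g = flip [ffun i => f i (+) g i].
Proof. by apply/permP=> [[i a]]; rewrite permM !permE /= ffunE addbA. Qed.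

Lemma flip0 : flip [ffun=> false] = 1.
Proof. by apply/permP=> [[i a]]; rewrite perm1 permE /= ffunE addbF. Qed.

Lemma group_set_flips : group_set flips.
Proof.
apply/group_setP; split; first by rewrite -flip0 imset_f.
by move=> _ _ /imsetP[f _ ->] /imsetP[g _ ->]; rewrite flipM imset_f.
Qed.
Canonical flips_group := Group group_set_flips.

Lemma abelem_flips : 2.-abelem flips.
Proof.
apply/abelemP=> //; split.
  apply/centsP=> _ /imsetP[f _ ->] _ /imsetP[g _ ->].
  by rewrite /commute !flipM; congr flip; apply/ffunP=> i; rewrite !ffunE addbC.
move=> _ /imsetP[f _ ->]; rewrite expgS expg1 flipM -flip0; congr flip.
by apply/ffunP=> i; rewrite !ffunE addbb.
Qed.

Lemma shiftX k x : (shift ^+ k) x = ((x.1 + k%:R)%R, x.2).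
Proof.
elim: k => [|k IHk]; first by rewrite perm1 addr0; case: x.
by rewrite expgSr permM IHk permE /= -addrA natr1.
Qed.

Lemma scaleX k x : (scale ^+ k) x = ((u ^+ k * x.1)%R, x.2).
Proof.
elim: k => [|k IHk]; first by rewrite perm1 mul1r; case: x.
by rewrite expgSr permM IHk permE /= mulrA -exprS.
Qed.

Let Fp0 k : (k%:R == 0 :> 'F_p)%R = (p %| k).
Proof. by rewrite -(dvdn_pcharf (pchar_Fp p_pr)). Qed.

Lemma order_shift : #[shift] = p.
Proof.
apply/eqP; rewrite eqn_dvd order_dvdn; apply/andP; split.
  by apply/eqP/permP=> x; rewrite shiftX perm1 (pcharf0 (pchar_Fp p_pr)) addr0;
    case: x.
have := congr1 (fun z : {perm T} => (z (0%R, false)).1) (expg_order shift).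
by rewrite /= shiftX perm1 /= add0r => /eqP; rewrite Fp0.
Qed.

Lemma order_scale : #[scale] = m.
Proof.
have scale1 k : (scale ^+ k == 1) = (m %| k).
  rewrite (prim_order_dvd prim_u); apply/eqP/eqP=> [|uk].
    move/(congr1 (fun z : {perm T} => (z (1%R, false)).1)).
    by rewrite /= scaleX perm1 /= mulr1.
  by apply/permP=> [[i a]]; rewrite scaleX perm1 uk mul1r.
by apply/eqP; rewrite eqn_dvd order_dvdn scale1 dvdnn -scale1 expg_order eqxx.
Qed.

Lemma shiftJ : shift ^ scale = shift ^+ u.
Proof.
apply: (mulgI scale); rewrite conjgE mulgA mulgV mul1g.
apply/permP=> [[i a]]; rewrite !permM shiftX !permE /=.
by rewrite mulrDr mulr1 natr_Zp.
Qed.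

Let H := <[shift]>%G.
Let C := <[scale]>%G.
Let B := (H <*> C)%G.
Let V := [~: flips, H]%G.

Let nHC : C \subset 'N(H).
Proof.
by rewrite cycle_subG inE -cycleJ cycle_subG shiftJ mem_cycle.
Qed.

Let tiHC : H :&: C = 1.
Proof.
apply/trivgP/subsetP=> _ /setIP[/cycleP[j ->] /cycleP[k E]].
have := congr1 (fun z : {perm T} => (z (0%R, false)).1) E.
by rewrite /= shiftX scaleX /= mulr0 add0r => /eqP;
  rewrite Fp0 inE -order_dvdn order_shift.
Qed.

Lemma affine_Frobenius : [Frobenius B = H ><| C].
Proof.
apply/Frobenius_semiregularP; rewrite ?sdprodEY //.
- by rewrite cycle_eq1 -order_gt1 order_shift prime_gt1.
- by rewrite cycle_eq1 -order_gt1 order_scale.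
move=> x /setD1P[nt_k /cycleP[k Dx]];
  apply/trivgP/subsetP=> _ /setIP[/cycleP[j ->] /cent1P cjk].
have := congr1 (fun z : {perm T} => (z (0%R, false)).1) cjk.
rewrite Dx /= !permM !(shiftX, scaleX) /= !(add0r, mulr0) => /eqP.
rewrite -subr_eq0 -[X in (_ - X)%R]mul1r -mulrBl mulf_eq0 subr_eq0 =>
  /orP[/eqP uk1|].
  case/eqP: nt_k; rewrite Dx; apply/permP=> [[i a]].
  by rewrite scaleX perm1 uk1 mul1r.
by rewrite Fp0 inE -order_dvdn order_shift.
Qed.

Lemma flipJ_shift f : flip f ^ shift = flip [ffun i => f (i - 1)%R].
Proof.
apply: (mulgI shift); rewrite conjgE mulgA mulgV mul1g.
by apply/permP=> [[i a]]; rewrite !permM !permE /= ffunE addrK.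
Qed.

Lemma flipJ_scale f : flip f ^ scale = flip [ffun i => f (u^-1 * i)%R].
Proof.
apply: (mulgI scale); rewrite conjgE mulgA mulgV mul1g.
by apply/permP=> [[i a]]; rewrite !permM !permE /= ffunE mulKr.
Qed.

Lemma flipsJ_shift : H \subset 'N(flips).
Proof.
rewrite cycle_subG inE; apply/subsetP=> _ /imsetP[_ /imsetP[f _ ->] ->].
by rewrite flipJ_shift imset_f.
Qed.

Lemma flipsJ_scale : C \subset 'N(flips).
Proof.
rewrite cycle_subG inE; apply/subsetP=> _ /imsetP[_ /imsetP[f _ ->] ->].
by rewrite flipJ_scale imset_f.
Qed.

Let nVB : B \subset 'N(V).
Proof.
rewrite join_subG normsRr ?flipsJ_shift //=.
by rewrite normsR // flipsJ_scale.
Qed.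

Let tiVB : V :&: B = 1.
Proof.
apply/trivgP/subsetP=> x /setIP[Vx]; rewrite /B /= norm_joinEr //.
case/mulsgP=> _ _ /cycleP[j ->] /cycleP[k ->] Dx.
have /imsetP[f _ Df] : x \in flips.
  by apply: subsetP Vx; rewrite commg_subl flipsJ_shift.
rewrite Df inE -flip0; apply/eqP; congr flip; apply/ffunP=> i.
have := congr1 (fun z : {perm T} => (z (i, false)).2) Dx.
by rewrite /= Df permM scaleX shiftX permE /= ffunE => ->.
Qed.

Let ntV : V :!=: 1.
Proof.
rewrite /= (sameP eqP commG1P) cent_cycle; apply/subsetPn.
pose f := [ffun i : 'F_p => i == 0%R]; exists (flip f); first exact: imset_f.
apply/cent1P=> /(congr1 (fun z : {perm T} => (z (0%R, false)).2)).
by rewrite /= !permM !permE /= !ffunE add0r eqxx oner_eq0.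
Qed.

Let sV_flips : V \subset flips.
Proof. by rewrite commg_subl flipsJ_shift. Qed.

Let coflips : coprime #|flips| #|H|.
Proof.
rewrite -orderE order_shift (pnat_coprime (abelem_pgroup abelem_flips)) //.
by rewrite pnatE // !inE; apply: contraTneq p_odd => ->.
Qed.

Let frobVH : [Frobenius V <*> H = V ><| H].
Proof.
apply/prime_FrobeniusP => //; first by rewrite -orderE order_shift.
split; last by rewrite coprime_abel_cent_TI ?flipsJ_shift
  ?(abelem_abelian abelem_flips).
rewrite sdprodEY //; first by rewrite (subset_trans _ nVB) ?joing_subl.
by apply/trivgP; rewrite -tiVB setIS ?joing_subl.
Qed.

Lemma affine_example :
    (forall k, coprime k m -> (k == 1 %[mod m]) || (k == m.-1 %[mod m])) ->
    p.-1 <= m.*2 ->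
  exists (gT : finGroupType) (G : {group gT}),
    [/\ two_Frobenius G, 2.-group 'F(G), Frobenius_cyclic (G / 'F(G)) p m,
        character_quadratic G & semi_rational G].
Proof.
move=> unit_m le_pm; exists {perm T}, (V <*> B)%G; pose G := (V <*> B)%G.
have defG : V ><| (H <*> C) = G by rewrite sdprodEY.
have cardH : #|H| = p by rewrite -orderE order_shift.
have cardC : #|C| = m by rewrite -orderE order_scale.
have abelV : 2.-abelem V := abelemS sV_flips abelem_flips.
have prH : prime #|H| by rewrite cardH.
have nilV : nilpotent V := abelian_nil (abelem_abelian abelV).
have defF : 'F(G) = V := Fitting_lower_ker defG frobVH affine_Frobenius nilV.
have unitC k : coprime k #|C| ->
  (k == 1 %[mod #|C|]) || (k == #|C|.-1 %[mod #|C|]).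
  by rewrite cardC; apply: unit_m.
have leHC : #|H|.-1 <= #|C|.*2 by rewrite cardH cardC.
have frobHC := affine_Frobenius; have cycC : cyclic C := cycle_cyclic scale.
have cycH : cyclic H := cycle_cyclic shift.
rewrite defF; split.
- exact: split_two_Frobenius defG frobVH frobHC.
- exact: abelem_pgroup abelV.
- by have := quotient_Frobenius_cyclic defG frobHC cycH cycC cardH cardC.
- exact: split_character_quadratic defG frobVH frobHC prH abelV unitC leHC.
exact: split_semi_rational defG frobVH frobHC prH abelV unitC leHC.
Qed.

End AffineExample.

(** * The six types *)

(** In each case the second entry is the multiplicative order of the chosen
    residue modulo the first one, and the units modulo m are 1 and -1 for m in
    {2, 3, 4, 6}. *)
Lemma examples_2group n m :
    (n, m) \in [:: (3, 2); (5, 4); (5, 2); (7, 3); (7, 6); (13, 6)] ->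
  exists (gT : finGroupType) (G : {group gT}),
    [/\ two_Frobenius G, 2.-group 'F(G), Frobenius_cyclic (G / 'F(G)) n m,
        character_quadratic G & semi_rational G].
Proof.
have example k j (u : 'F_k) : prime k -> odd k -> 1 < j ->
    all (fun i => (u ^+ i == 1)%R == (i == j)) (iota 1 j) ->
    all (fun i => coprime i j ==> (i == 1%N) || (i == j.-1)) (iota 0 j) ->
    k.-1 <= j.*2 -> exists (gT : finGroupType) (G : {group gT}),
    [/\ two_Frobenius G, 2.-group 'F(G), Frobenius_cyclic (G / 'F(G)) k j,
        character_quadratic G & semi_rational G].
  move=> k_pr k_odd j_gt1 /allP ord_u /allP pm le_kj; have j_gt0 := ltnW j_gt1.
  apply: (affine_example (u := u) k_pr k_odd j_gt1) => // [|i co_ij].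
    apply/andP; split=> //; apply/forallP=> i;
      rewrite unity_rootE (eqP (ord_u i.+1 _)) //.
    by rewrite mem_iota /= add1n ltnS; apply: ltn_ord.
  have := pm (i %% j); rewrite mem_iota ltn_mod j_gt0 coprime_modl co_ij.
  by rewrite (modn_small j_gt1) [_.-1 %% j]modn_small ?prednK //; apply.
rewrite !inE => /or4P[/eqP[-> ->]|/eqP[-> ->]|/eqP[-> ->]|/or3P[]/eqP[-> ->]].
- by apply: (example 3 2 2%:R%R isT isT isT); vm_compute.
- by apply: (example 5 4 2%:R%R isT isT isT); vm_compute.
- by apply: (example 5 2 4%:R%R isT isT isT); vm_compute.
- by apply: (example 7 3 2%:R%R isT isT isT); vm_compute.
- by apply: (example 7 6 3%:R%R isT isT isT); vm_compute.
by apply: (example 13 6 4%:R%R isT isT isT); vm_compute.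
Qed.

Theorem theoremA :
  (forall (gT : finGroupType) (G : {group gT}),
     two_Frobenius G ->
     character_quadratic G \/ semi_rational G ->
     (2.-group 'F(G) /\
      (Frobenius_cyclic (G / 'F(G)) 3 2 \/ Frobenius_cyclic (G / 'F(G)) 5 4))
     \/
     ({subset \pi('F(G)) <= [:: 2; 3]} /\
      [\/ Frobenius_cyclic (G / 'F(G)) 5 2, Frobenius_cyclic (G / 'F(G)) 7 3,
          Frobenius_cyclic (G / 'F(G)) 7 6
        | Frobenius_cyclic (G / 'F(G)) 13 6]))
  /\
  (forall n m : nat, (n, m) \in [:: (3, 2); (5, 4)] ->
     exists (gT : finGroupType) (G : {group gT}),
       [/\ two_Frobenius G, 2.-group 'F(G), Frobenius_cyclic (G / 'F(G)) n m,
           character_quadratic G & semi_rational G])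
  /\
  (forall n m : nat, (n, m) \in [:: (5, 2); (7, 3); (7, 6); (13, 6)] ->
     exists (gT : finGroupType) (G : {group gT}),
       [/\ two_Frobenius G, {subset \pi('F(G)) <= [:: 2; 3]},
           Frobenius_cyclic (G / 'F(G)) n m,
           character_quadratic G & semi_rational G]).
Proof.
split; first exact: quadratic_two_Frobenius.
split=> n m nm.
  by apply: examples_2group; move: nm; rewrite !inE => /orP[]->; rewrite ?orbT.
have [|gT [G [frobG G2 FC cq sr]]] := @examples_2group n m.
  by move: nm; rewrite !inE => /or4P[]->; rewrite ?orbT.
exists gT, G; split=> // q; rewrite mem_primes => /and3P[q_pr _ q_dv].
by rewrite (eqnP (pgroupP G2 q q_pr q_dv)).
Qed.
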